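(* For every integer $r>0$ there exists an asymmetric shape datum $b^{\mathrm A}$ for $(\mathbf{Y},\leftharpoondown_r,\leftharpoonup_r,\{0,1\}^r)$ such that whenever $(a,\lambda)=b^{\mathrm A}_{\mu,\nu}(\kappa)$, one has $$\mathrm{spin}^{\mathrm t}(\kappa/\mu)+\mathrm{spin}(\kappa/\nu)=\mathrm{spin}(\mu/\lambda)+\mathrm{spin}^{\mathrm t}(\nu/\lambda)+\mathrm{n}(a).$$ Hence, in $\mathrm{End}(\mathbb{Z}[q^{1/2}]\mathbf{Y})[[X,Y]]$, $$\widetilde D^r_{q^{1/2},Y}\circ U^r_{q^{1/2},X}=\bigl(U^r_{q^{1/2},X}\circ\widetilde D^r_{q^{1/2},Y}\bigr)\prod_{i=0}^{r-1}(1+q^iXY),$$ where $U^r_{q^{1/2},X}(\lambda)=\sum_{\mu:\,\lambda\leftharpoondown_r\mu}q^{\mathrm{spin}(\mu/\lambda)}X^{|\mu/\lambda|_r}\mu$ and $\widetilde D^r_{q^{1/2},Y}(\lambda)=\sum_{\mu:\,\mu\leftharpoonup_r\lambda}q^{\mathrm{spin}^{\mathrm t}(\lambda/\mu)}Y^{|\lambda/\mu|_r}\mu$ for all $\lambda\in\mathbf{Y}$.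
   Context: $\mathbf{Y}$ is the set of all partitions, identified with their Young diagrams (square $(i,j)$ in row $i$, column $j$, both numbered from $0$; rows numbered downwards); $|\lambda|$ is the number of squares of $\lambda$, and $|\lambda|_r=\lfloor|\lambda|/r\rfloor$. Diagonal $d_k$ is $\{(i,j):j-i=k\}$. For $\lambda\subset\mu$, $\mu/\lambda$ is an $r$-ribbon (written $\lambda\prec_r\mu$) if the skew diagram consists of exactly one square on each of $r$ consecutive diagonals; its head is its top-rightmost square, and its height is one less than the number of rows it meets. $\mu/\lambda$ is a horizontal (respectively vertical) $r$-ribbon strip, written $\lambda\leftharpoondown_r\mu$ (respectively $\lambda\leftharpoonup_r\mu$), if there is a (possibly trivial) chain $\lambda=\lambda^{(0)}\prec_r\cdots\prec_r\lambda^{(p)}=\mu$ such that, with $d_{k_t}$ the diagonal containing the head of $\lambda^{(t)}/\lambda^{(t-1)}$, one has $k_1<k_2<\cdots<k_p$ (respectively $k_1>k_2>\cdots>k_p$). (Equivalently for the vertical case: the transposed shapes form a horizontal $r$-ribbon strip.) Such a chain is unique and called the standardisation of $\mu/\lambda$ as a horizontal (respectively vertical) $r$-ribbon strip. In either case $|\mu/\lambda|_r=p$, and $\mathrm{spin}(\mu/\lambda)$ (respectively $\mathrm{spin}^{\mathrm t}(\mu/\lambda)$) is half the sum of the heights of the ribbons $\lambda^{(t)}/\lambda^{(t-1)}$ in that standardisation. For $a=(a_0,\dots,a_{r-1})\in\{0,1\}^r$ put $|a|=\sum_{i=0}^{r-1}a_i$ and $\mathrm{n}(a)=\sum_{i=0}^{r-1}i\,a_i$.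 An (asymmetric) shape datum for $(\mathbf{Y},\leftharpoondown_r,\leftharpoonup_r,\{0,1\}^r)$ is a family of bijections, one for each pair $\mu,\nu\in\mathbf{Y}$, $$b_{\mu,\nu}:\{\kappa\in\mathbf{Y}:\mu\leftharpoonup_r\kappa,\ \nu\leftharpoondown_r\kappa\}\to\{(a,\lambda)\in\{0,1\}^r\times\mathbf{Y}:\lambda\leftharpoondown_r\mu,\ \lambda\leftharpoonup_r\nu\},$$ such that $|\kappa|_r-|\nu|_r-|\mu|_r+|\lambda|_r=|a|$ whenever $(a,\lambda)=b_{\mu,\nu}(\kappa)$. $\mathbb{Z}[q^{1/2}]\mathbf{Y}$ is the free $\mathbb{Z}[q^{1/2}]$-module on the set $\mathbf{Y}$, and $q^{1/2},X,Y$ are indeterminates; elements of $\mathrm{End}(\mathbb{Z}[q^{1/2}]\mathbf{Y})[[X,Y]]$ act on (power series with coefficients in) $\mathbb{Z}[q^{1/2}]\mathbf{Y}$, and are composed accordingly. *)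

(* Defs.v *)
From HB Require Import structures.
From mathcomp Require Import all_boot all_order all_algebra.
From mathcomp Require Import finmap boolp classical_sets functions cardinality fsbigop.
From mathcomp Require Import freeg.

Set Implicit Arguments.
Unset Strict Implicit.
Unset Printing Implicit Defensive.

Import Order.TTheory GRing.Theory Num.Theory.

Local Open Scope classical_set_scope.
Local Open Scope ring_scope.

Record intpart := IntPart {
  parts :> seq nat;
  _ : sorted geq parts && (0%N \notin parts) }.

HB.instance Definition _ := [isSub for parts].
HB.instance Definition _ := [Choice of intpart by <:].

(* A square (i, j) is in row i and column j, both numbered from 0. *)
Definition square := (nat * nat)%type.

Definition diagram (lam : intpart) : set square :=
  [set s | (s.2 < nth 0 lam s.1)%N].

Definition skew (lam mu : intpart) : set square :=
  diagram mu `\` diagram lam.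

Definition psize (lam : intpart) : nat := sumn lam.

Definition rsize (r : nat) (lam : intpart) : nat := (psize lam %/ r)%N.

(* The r-size of the skew shape mu / lam, for lam contained in mu. *)
Definition skew_rsize (r : nat) (lam mu : intpart) : nat :=
  ((psize mu - psize lam) %/ r)%N.

Definition diag (s : square) : int := s.2%:Z - s.1%:Z.

(* The bijection says that the squares of mu / lam all lie on the diagonals
   k, ..., k + r - 1, with exactly one square on each of these. *)
Definition ribbon (r : nat) (lam mu : intpart) : Prop :=
  diagram lam `<=` diagram mu /\
  exists k : int, set_bij (skew lam mu) [set d | k <= d < k + r%:Z] diag.

(* The top-rightmost square of the ribbon mu / lam. *)
Definition head_square (lam mu : intpart) : square :=
  xget (0%N, 0%N) [set s | skew lam mu s /\
    forall s', skew lam mu s' -> (s.1 <= s'.1)%N /\ (s'.2 <= s.2)%N].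

Definition height (lam mu : intpart) : nat :=
  #|` fset_set [set s.1 | s in skew lam mu]|.-1.

(* A chain lam = lam^(0), lam^(1), ..., lam^(p) = mu is encoded by the sequence
   c of its p last members, the starting point lam being kept apart. *)
Definition ribbon_chain (r : nat) (lam mu : intpart) (c : seq intpart) :=
  path (fun x y => `[< ribbon r x y >]) lam c /\ last lam c = mu.

Definition head_diags (lam : intpart) (c : seq intpart) : seq int :=
  pairmap (fun x y => diag (head_square x y)) lam c.

Definition hstandard (r : nat) (lam mu : intpart) : set (seq intpart) :=
  [set c | ribbon_chain r lam mu c /\ sorted <%R (head_diags lam c)].

Definition vstandard (r : nat) (lam mu : intpart) : set (seq intpart) :=
  [set c | ribbon_chain r lam mu c /\ sorted >%R (head_diags lam c)].

Definition hstrip (r : nat) (lam mu : intpart) : Prop :=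
  exists c, hstandard r lam mu c.

Definition vstrip (r : nat) (lam mu : intpart) : Prop :=
  exists c, vstandard r lam mu c.

Definition chain_height (lam : intpart) (c : seq intpart) : nat :=
  sumn (pairmap height lam c).

(* Standardisations are unique, so [xget] returns the standardisation whenever
   mu / lam is a strip of the kind considered. As spins are half-integers, we
   first define twice the spin, a natural number. *)
Definition dspin (r : nat) (lam mu : intpart) : nat :=
  chain_height lam (xget [::] (hstandard r lam mu)).

Definition dspint (r : nat) (lam mu : intpart) : nat :=
  chain_height lam (xget [::] (vstandard r lam mu)).

Definition spin (r : nat) (lam mu : intpart) : rat := (dspin r lam mu)%:R / 2.

Definition spint (r : nat) (lam mu : intpart) : rat := (dspint r lam mu)%:R / 2.

Definition weight (r : nat) (a : {ffun 'I_r -> bool}) : nat :=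
  (\sum_(i < r) a i)%N.

Definition nstat (r : nat) (a : {ffun 'I_r -> bool}) : nat :=
  (\sum_(i < r) i * a i)%N.

(* The value of [b mu nu kappa] is only relevant when kappa is in the domain
   of the bijection b_{mu,nu}. *)
Definition shape_datum (r : nat)
    (b : intpart -> intpart -> intpart ->
         {ffun 'I_r -> bool} * intpart) : Prop :=
  forall mu nu : intpart,
    set_bij [set kappa | vstrip r mu kappa /\ hstrip r nu kappa]
            [set p : {ffun 'I_r -> bool} * intpart |
               hstrip r p.2 mu /\ vstrip r p.2 nu]
            (b mu nu) /\
    forall kappa a lam, vstrip r mu kappa -> hstrip r nu kappa ->
      b mu nu kappa = (a, lam) ->
      (rsize r kappa)%:Z - (rsize r nu)%:Z - (rsize r mu)%:Z + (rsize r lam)%:Z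
      = (weight a)%:Z.

Section Lift.
Variables (R : nzRingType) (K : choiceType) (M : lmodType R) (f : K -> M).

Fact fglift_is_linear : linear (fglift f).
Proof.
have addB : {morph fglift f : x y / x - y} := lift_is_additive f.
have add0 : fglift f 0 = 0 by have := addB 0 0; rewrite !subrr.
have addD : {morph fglift f : x y / x + y}.
  by move=> x y; have := addB (x + y) y; rewrite addrK => ->; rewrite subrK.
have sumE (s : seq K) (g : K -> R) :
    fglift f (\sum_(k <- s) << g k *g k >>) = \sum_(k <- s) g k *: f k.
  by rewrite (big_morph _ addD add0); apply: eq_bigr => k _; rewrite liftU.
move=> c x y; rewrite addD; congr (_ + _).
rewrite -{2}[x]freeg_sumE sumE scaler_sumr [LHS]sumE.
by apply: eq_bigr => k _; rewrite scalerA.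
Qed.

HB.instance Definition _ :=
  GRing.isLinear.Build R {freeg K / R} M _ (fglift f) fglift_is_linear.

End Lift.

(* End(V)[[X,Y]]: the entry at m, n of a series is its coefficient of X^m Y^n. *)
Definition opseries (R : nzRingType) (V : lmodType R) :=
  nat -> nat -> {linear V -> V}.

Section Operations.
Variables (R : comNzRingType) (V : lmodType R).
Variables (F G : opseries V) (P : {poly {poly R}}) (m n : nat).

Definition comp_coef (v : V) : V :=
  \sum_(i < m.+1) \sum_(j < n.+1) F i j (G (m - i)%N (n - j)%N v).

Fact comp_coef_is_linear : linear comp_coef.
Proof.
move=> c x y; rewrite /comp_coef scaler_sumr -big_split; apply: eq_bigr => i _.
rewrite scaler_sumr -big_split; apply: eq_bigr => j _.
by rewrite !linearP.
Qed.

HB.instance Definition _ :=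
  GRing.isLinear.Build R V V _ comp_coef comp_coef_is_linear.

(* A polynomial in X and Y is a polynomial in X whose coefficients are
   polynomials in Y. *)
Definition scale_coef (v : V) : V :=
  \sum_(i < m.+1) \sum_(j < n.+1) P`_(m - i)`_(n - j) *: F i j v.

Fact scale_coef_is_linear : linear scale_coef.
Proof.
move=> c x y; rewrite /scale_coef scaler_sumr -big_split; apply: eq_bigr => i _.
rewrite scaler_sumr -big_split; apply: eq_bigr => j _.
by rewrite linearP scalerDr !scalerA mulrC.
Qed.

HB.instance Definition _ :=
  GRing.isLinear.Build R V V _ scale_coef scale_coef_is_linear.

End Operations.

Definition opcomp (R : comNzRingType) (V : lmodType R) (F G : opseries V) :
  opseries V := fun m n => comp_coef F G m n.

Definition opscale (R : comNzRingType) (V : lmodType R) (F : opseries V)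
  (P : {poly {poly R}}) : opseries V := fun m n => scale_coef F P m n.

(* The ring Z[q^(1/2)]: the indeterminate of {poly int} is q^(1/2). *)
Notation Zq := {poly int}.
Definition qhalf : Zq := 'X.
Definition q : Zq := qhalf ^+ 2.

Notation ZqY := {freeg intpart / Zq}.

Definition varX : {poly {poly Zq}} := 'X.
Definition varY : {poly {poly Zq}} := 'X%:P.

(* For r > 0 the sums over mu have finitely many terms, since |mu| is at most
   |lam| + r * m in the first one and mu is contained in lam in the second one.
   The factor q^spin is (q^(1/2))^dspin. *)
Definition Ucoef (r m : nat) (lam : intpart) : ZqY :=
  \sum_(mu \in [set mu | hstrip r lam mu /\ skew_rsize r lam mu = m])
    qhalf ^+ dspin r lam mu *: << mu >>.

Definition Dtcoef (r n : nat) (lam : intpart) : ZqY :=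
  \sum_(mu \in [set mu | vstrip r mu lam /\ skew_rsize r mu lam = n])
    qhalf ^+ dspint r mu lam *: << mu >>.

Definition opU (r : nat) : opseries ZqY :=
  fun m n => fglift (if n == 0%N then Ucoef r m else fun=> 0).

Definition opDt (r : nat) : opseries ZqY :=
  fun m n => fglift (if m == 0%N then Dtcoef r n else fun=> 0).

(* Main.v *)
(** Encode a partition by its beads lam_i - i.  Adding an r-ribbon moves a bead
    from p to the free place p + r, and the height is the number of beads
    strictly in between.  On functions of a partition, let A_p be "do nothing, or
    add the ribbon at p with weight X q^(height/2)" and B_p "do nothing, or remove
    the ribbon at p with weight Y q^(height/2)".  The products of the A_p and of
    the B_p in increasing order of p are the transposes of U and of D~.  For
    distinct p and p', A_p and B_p' commute.  For p = p' they commute up to a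
    gauge: if W_p multiplies by the product of the 1 + q^i X Y for c <= i < r, with
    c the number of beads in [p, p + r), then W_p A_p B_p = B_p A_p W_(p+1).
    Telescoping over all p, c goes from r to 0, so W goes from 1 to the full
    product; this is the commutation relation.  Its matrix coefficients are
    generating functions with natural coefficients, so the two finite sets to be
    matched by the shape datum have equally many elements of each weight. *)

From mathcomp Require Import all_boot all_order all_algebra.
From mathcomp Require Import finmap boolp classical_sets functions cardinality fsbigop.
From mathcomp Require Import freeg.
From mathcomp Require Import zify ring.
(* Imported last: MathComp has another [skew]. *)
Require Import Defs.

Set Implicit Arguments.
Unset Strict Implicit.
Unset Printing Implicit Defensive.

Import Order.TTheory GRing.Theory Num.Theory.

Local Open Scope ring_scope.

(** * Partitions described by the lengths of their diagonals *)

Section Diagonals.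
Implicit Types (lam mu : intpart) (k p : int) (i j : nat).

Lemma nth_intpart_le lam i j : (i <= j)%N -> (nth 0%N lam j <= nth 0%N lam i)%N.
Proof.
move=> le_ij; case: (ltnP j (size lam)) => [lt_j|le_j]; last by rewrite nth_default.
have /andP[srt _] : sorted geq lam && (0%N \notin parts lam) := valP lam.
have geq_trans : transitive geq by move=> a b c /=; lia.
by apply: (sorted_leq_nth geq_trans _ _ srt) => //; rewrite ?inE //; [exact: leqnn | lia].
Qed.

Lemma nth_intpart_gt0 lam i : (0 < nth 0%N lam i)%N = (i < size lam)%N.
Proof.
case: (ltnP i (size lam)) => [lt_i|le_i]; last by rewrite nth_default.
have /andP[_ n0] : sorted geq lam && (0%N \notin parts lam) := valP lam.
by rewrite lt0n; apply: contra n0 => /eqP <-; rewrite mem_nth.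
Qed.

Lemma intpart_nth_inj lam mu : nth 0%N lam =1 nth 0%N mu -> lam = mu.
Proof.
move=> eq_n; have eq_s i : (i < size lam)%N = (i < size mu)%N.
  by rewrite -!nth_intpart_gt0 eq_n.
apply/val_inj/(@eq_from_nth _ 0%N) => [|i _]; last exact: eq_n.
by have := eq_s (size lam); have := eq_s (size mu); rewrite /=; lia.
Qed.

Lemma size_le_psize lam : (size lam <= psize lam)%N.
Proof.
rewrite /psize; have : forall i, (i < size lam)%N -> (0 < nth 0%N lam i)%N.
  by move=> i; rewrite nth_intpart_gt0.
elim: (parts lam) => //= a s IH pos; have := pos 0%N isT; rewrite /= => a_gt0.
by have := IH (fun i => pos i.+1); lia.
Qed.

Lemma head_le_psize lam : (nth 0%N lam 0 <= psize lam)%N.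
Proof. by rewrite /psize; case: (parts lam) => //= a s; lia. Qed.

Fact dg_ex lam k : exists i, (nth 0%N lam i)%:Z - i%:Z <= k.
Proof.
by exists (size lam + `|k|)%N; rewrite nth_default ?leq_addr//; lia.
Qed.

(* The squares of lam on the diagonal d_k are the (i, i + k) with
   max(0, -k) <= i < dg lam k. *)
Definition dg lam k : nat := ex_minn (dg_ex lam k).

Lemma dgP lam k i : (i < dg lam k)%N = (k < (nth 0%N lam i)%:Z - i%:Z).
Proof.
rewrite /dg; case: ex_minnP => m m_le m_min.
apply/idP/idP => [lt_im|]; first by rewrite ltNge; apply/negP => /m_min; lia.
apply: contraLR; rewrite -leqNgt -leNgt => le_mi.
by have := nth_intpart_le lam le_mi; lia.
Qed.

Lemma in_diagram lam i j : diagram lam (i, j) <-> (i < dg lam (j%:Z - i%:Z))%N.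
Proof. by rewrite dgP /diagram /=; split; lia. Qed.

Lemma dg_inj lam mu : dg lam =1 dg mu -> lam = mu.
Proof.
move=> eq_dg; apply: intpart_nth_inj => i.
have eqP k : (k < (nth 0%N lam i)%:Z - i%:Z) = (k < (nth 0%N mu i)%:Z - i%:Z).
  by rewrite -!dgP eq_dg.
have := eqP ((nth 0%N lam i)%:Z - i%:Z); have := eqP ((nth 0%N mu i)%:Z - i%:Z).
by lia.
Qed.

Lemma dg_ge lam k : - k <= (dg lam k)%:Z.
Proof.
by rewrite leNgt; apply/negP => lt_k; have := dgP lam k (dg lam k); rewrite ltnn; lia.
Qed.

Lemma dg_step lam k : (dg lam k <= dg lam (k - 1) <= (dg lam k).+1)%N.
Proof.
apply/andP; split; rewrite leqNgt; apply/negP => lt_k.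
  by move: (lt_k); rewrite dgP; have := dgP lam (k - 1) (dg lam (k - 1)); rewrite ltnn; lia.
move: lt_k; rewrite dgP; have := dgP lam k (dg lam k); rewrite ltnn.
by have := nth_intpart_le lam (leqnSn (dg lam k)); lia.
Qed.

Lemma dg_mono lam k k' : k <= k' -> (dg lam k' <= dg lam k)%N.
Proof.
move=> le_k; have -> : k' = k + `|(k' - k)%R|%N%:Z by lia.
elim: `|(k' - k)%R|%N => [|n IH]; first by rewrite addr0.
have := dg_step lam (k + n.+1%:Z); have -> : k + n.+1%:Z - 1 = k + n%:Z by lia.
by lia.
Qed.

Lemma dg_lip lam k k' : k <= k' -> (dg lam k)%:Z + k <= (dg lam k')%:Z + k'.
Proof.
move=> le_k; have -> : k' = k + `|(k' - k)%R|%N%:Z by lia.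
elim: `|(k' - k)%R|%N => [|n IH]; first by rewrite addr0.
have := dg_step lam (k + n.+1%:Z); have -> : k + n.+1%:Z - 1 = k + n%:Z by lia.
by lia.
Qed.

Lemma dg_ivt lam k k' i : k <= k' -> (dg lam k' <= i <= dg lam k)%N ->
  exists2 x, k <= x <= k' & dg lam x = i.
Proof.
move=> le_k; have -> : k' = k + `|(k' - k)%R|%N%:Z by lia.
elim: `|(k' - k)%R|%N => [|n IH].
  by rewrite addr0 => H; exists k; [rewrite lexx | lia].
have st := dg_step lam (k + n.+1%:Z).
have e : k + n.+1%:Z - 1 = k + n%:Z by lia.
rewrite e in st; move=> H.
case: (ltnP i (dg lam (k + n%:Z))) => [lt_i|le_i].
  by exists (k + n.+1%:Z); [lia|move: H st lt_i; clear; lia].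
by have [|x x_in <-] := IH; [lia | exists x => //; lia].
Qed.

Lemma dg_low lam k : k <= - (psize lam)%:Z -> (dg lam k)%:Z = - k.
Proof.
move=> le_k; apply/le_anti; rewrite dg_ge andbT leNgt; apply/negP.
have := size_le_psize lam => le_s; case: k le_k => k le_k lt_k.
  have k0 : k = 0%N by lia.
  have := dgP lam k 0%N; have := head_le_psize lam; lia.
have := dgP lam (Negz k) k.+1; rewrite (nth_default 0%N) ?subr0 //; lia.
Qed.

Lemma dg_high lam k : (psize lam)%:Z <= k -> dg lam k = 0%N.
Proof.
move=> le_k; have := dgP lam k 0; have := head_le_psize lam; lia.
Qed.

(** Outside [-N, N) the value [dg mu p] is the least possible one, -p or 0, so it cannot exceed
    [dg lam p]. Hence finite windows of positions suffice. *)
Lemma dg_bound lam mu N p : (psize mu <= N)%N -> (dg lam p < dg mu p)%N ->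
  - N%:Z <= p < - N%:Z + (N + N)%N%:Z.
Proof.
move=> le_N lt_p; case: (leP (psize mu)%:Z p) => [/dg_high|]; first by lia.
by case: (leP p (- (psize mu)%:Z)) => [/dg_low|]; have := dg_ge lam p; lia.
Qed.

(** The conditions characterise the functions [dg]: the square (i, j) is put in the diagram when i <
    f (j - i), and the bound on the steps of f makes these squares form left-justified rows of
    weakly decreasing lengths. *)
Lemma dg_exists (f : int -> nat) (N : nat) :
    (forall k, (f k <= f (k - 1)%R <= (f k).+1)%N) ->
    (forall k, k <= - N%:Z -> (f k)%:Z = - k) ->
    (forall k, N%:Z <= k -> f k = 0%N) ->
  exists lam, dg lam =1 f.
Proof.
move=> f_step f_low f_high.
have f_mono k n : (f (k + n%:Z)%R <= f k)%N.
  elim: n => [|n IH]; first by rewrite addr0.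
  have e : k + n.+1%:Z - 1 = k + n%:Z by lia.
  have := f_step (k + n.+1%:Z); rewrite e; lia.
have f_monoS k n : (f k <= f (k + n%:Z)%R + n)%N.
  elim: n => [|n IH]; first by rewrite addr0 addn0.
  have e : k + n.+1%:Z - 1 = k + n%:Z by lia.
  have := f_step (k + n.+1%:Z); rewrite e; lia.
have row_ex i : exists j : nat, (f (j%:Z - i%:Z)%R <= i)%N.
  by exists (i + N)%N; rewrite f_high //; lia.
pose row i := ex_minn (row_ex i).
have rowP i j : (j < row i)%N = (i < f (j%:Z - i%:Z)%R)%N.
  rewrite /row; case: ex_minnP => m m_le m_min; apply/idP/idP => [lt_jm|].
    by rewrite ltnNge; apply/negP => /m_min; lia.
  apply: contraLR; rewrite -!leqNgt => le_mj.
  have := f_mono (m%:Z - i%:Z) (j - m)%N.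
  have -> : m%:Z - i%:Z + (j - m)%N%:Z = j%:Z - i%:Z by lia.
  lia.
have row_mono i j : (i <= j)%N -> (row j <= row i)%N.
  move=> le_ij; rewrite leqNgt rowP -leqNgt; rewrite leqNgt; apply/negP.
  have : (row i < row i)%N = false by rewrite ltnn.
  rewrite rowP => H Hj; have := f_monoS ((row i)%:Z - j%:Z) (j - i)%N.
  have -> : (row i)%:Z - j%:Z + (j - i)%N%:Z = (row i)%:Z - i%:Z by lia.
  by lia.
have row_0 i : (N <= i)%N -> row i = 0%N.
  move=> le_Ni; apply/eqP; rewrite -leqn0 leqNgt rowP.
  by have := f_low (0%:Z - i%:Z); lia.
(* A partition has no zero parts. As the rows decrease weakly, only trailing zeros are dropped,
   which [nth] with default 0 does not see. *)
pose s := [seq x <- mkseq row N | (0 < x)%N].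
have nth_s i : nth 0%N s i = row i.
  have srt : sorted geq (mkseq row N).
    apply/(sortedP 0%N) => j; rewrite size_mkseq => lt_j.
    by rewrite !nth_mkseq ?(ltnW lt_j) //=; apply: row_mono.
  have all_le a t : path geq a t -> (0 < a)%N = false -> forall j, nth 0%N t j = 0%N.
    elim: t a => [|b t IH] a //=; first by move=> _ _ j; rewrite nth_nil.
    case/andP=> ab pt a0 [|j] /=; first lia.
    by apply: IH pt _ j; lia.
  have filt t : sorted geq t -> forall j, nth 0%N [seq x <- t | (0 < x)%N] j = nth 0%N t j.
    elim: t => [|a t IH] //= pt j; case: ifP => a0.
      by case: j => //= j; apply: IH (path_sorted pt) j.
    rewrite (IH (path_sorted pt)) (all_le _ _ pt a0).
    by case: j => [|j] /=; [lia | rewrite (all_le _ _ pt a0)].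
  rewrite /s filt //; case: (ltnP i N) => [lt_i|le_i]; first by rewrite nth_mkseq.
  by rewrite nth_default ?size_mkseq // row_0.
have s_part : sorted geq s && (0%N \notin s).
  rewrite mem_filter /= andbT; apply/(sortedP 0%N) => j _.
  by rewrite !nth_s; apply: row_mono.
exists (IntPart s_part) => k.
have lt_eq i : (i < dg (IntPart s_part) k)%N = (i < f k)%N.
  rewrite dgP /= nth_s.
  have [le0|lt0] := leP 0 (k + i%:Z).
    have := rowP i `|(k + i%:Z)%R|%N; have -> : `|(k + i%:Z)%R|%N%:Z - i%:Z = k by lia.
    by lia.
  have := f_mono (k - N%:Z) N; have -> : k - N%:Z + N%:Z = k by lia.
  have := f_monoS (- N%:Z - `|k|%N%:Z) (`|k|%N + N + `|k|)%N.
  (* Here k + i < 0, so the left side holds trivially; the right side then follows from -k <= f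
     k. *)
  have ge : (- k <= (f k)%:Z).
    have [|] := leP k (- N%:Z); first by move=> /f_low ->.
    move=> lt_k; have := f_monoS (- N%:Z) `|(k + N%:Z)%R|%N.
    have -> : - N%:Z + `|(k + N%:Z)%R|%N%:Z = k by lia.
    by have := f_low (- N%:Z); lia.
  by lia.
have := lt_eq (f k); have := lt_eq (dg (IntPart s_part) k); lia.
Qed.

End Diagonals.

(** * Ribbons as bead moves *)

Section Ribbons.
Variables (r : nat) (r_gt0 : (0 < r)%N).
Implicit Types (lam mu : intpart) (k p : int) (i j : nat).

(* The integers k with dg lam k < dg lam (k - 1) are the beads lam_i - i of the abacus of lam, and
   the addition moves a bead from p to p + r. *)
Definition shift p lam mu : Prop :=
  forall k, dg mu k = (dg lam k + (p <= k < p + r%:Z)%R)%N.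

(** In terms of beads: p is occupied and p + r is free. For [removable] it is the reverse. *)
Definition addable p lam : bool :=
  (dg lam p < dg lam (p - 1))%N && (dg lam (p + r%:Z - 1) == dg lam (p + r%:Z)).

Definition removable p mu : bool :=
  (dg mu (p + r%:Z) < dg mu (p + r%:Z - 1))%N && (dg mu (p - 1) == dg mu p).

(** The number of beads strictly between p and p + r. *)
Definition ribbon_height p lam : nat := (dg lam p - dg lam (p + r%:Z - 1))%N.

(** The default of [xget] is a junk value: the operators and lists below use the result only when
    the move is possible. *)
Definition add_ribbon p lam : intpart := xget lam [set mu | shift p lam mu].
Definition del_ribbon p mu : intpart := xget mu [set lam | shift p lam mu].

Lemma shift_funl p lam mu mu' : shift p lam mu -> shift p lam mu' -> mu = mu'.
Proof. by move=> s s'; apply: dg_inj => k; rewrite s s'. Qed.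

Lemma shift_funr p lam lam' mu : shift p lam mu -> shift p lam' mu -> lam = lam'.
Proof. by move=> s s'; apply: dg_inj => k; have := s k; rewrite s'; lia. Qed.

Lemma shift_addable p lam mu : shift p lam mu -> addable p lam.
Proof.
move=> s; rewrite /addable.
have := s p; have := s (p - 1); have := s (p + r%:Z); have := s (p + r%:Z - 1).
have := dg_step mu p; have := dg_step lam p; have := dg_step lam (p + r%:Z).
by have := dg_step mu (p + r%:Z); lia.
Qed.

Lemma shift_removable p lam mu : shift p lam mu -> removable p mu.
Proof.
move=> s; rewrite /removable.
have := s p; have := s (p - 1); have := s (p + r%:Z); have := s (p + r%:Z - 1).
have := dg_step mu p; have := dg_step lam p; have := dg_step lam (p + r%:Z).
by have := dg_step mu (p + r%:Z); lia.
Qed.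

Lemma add_ribbonP p lam : addable p lam -> shift p lam (add_ribbon p lam).
Proof.
case/andP=> lt_p /eqP eq_pr.
have [|||mu mu_eq] := @dg_exists (fun k => (dg lam k + (p <= k < p + r%:Z)%R)%N)
    (psize lam + `|p|%N + r).
- move=> k; have st := dg_step lam k.
  have [->|nep] := eqVneq k p; first by have := dg_step lam p; lia.
  have [->|nepr] := eqVneq k (p + r%:Z); first by rewrite eq_pr; lia.
  by lia.
- by move=> k le_k; have := @dg_low lam k; lia.
- by move=> k le_k; rewrite dg_high; lia.
by apply: (@xgetPex _ lam [set mu | shift p lam mu]); exists mu.
Qed.

Lemma del_ribbonP p mu : removable p mu -> shift p (del_ribbon p mu) mu.
Proof.
case/andP=> lt_p /eqP eq_pr.
(* The bead at p + r makes [dg mu] positive at p + r - 1, hence on all of [p, p + r); the truncated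
   subtraction of 1 below is therefore exact. *)
have pos k : p <= k < p + r%:Z -> (dg mu (p + r%:Z - 1) <= dg mu k)%N.
  move=> k_in; have [n ->] : exists n : nat, k = p + r%:Z - 1 - n%:Z.
    by exists `|(p + r%:Z - 1 - k)%R|%N; lia.
  elim: n => [|n IH]; first by rewrite subr0.
  have := dg_step mu (p + r%:Z - 1 - n%:Z).
  have -> : p + r%:Z - 1 - n%:Z - 1 = p + r%:Z - 1 - n.+1%:Z by lia.
  by lia.
have [|||lam lam_eq] := @dg_exists (fun k => (dg mu k - (p <= k < p + r%:Z)%R)%N)
    (psize mu + `|p|%N + r).
- move=> k; have st := dg_step mu k; have := pos k; have := pos (k - 1).
  have [->|nep] := eqVneq k p; first by have := dg_step mu p; lia.
  have [->|nepr] := eqVneq k (p + r%:Z); first by have := dg_step mu (p + r%:Z); lia.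
  by lia.
- by move=> k le_k; have := @dg_low mu k; lia.
- by move=> k le_k; rewrite dg_high; lia.
apply: (@xgetPex _ mu [set lam | shift p lam mu]); exists lam => k.
by have := pos k; rewrite lam_eq; lia.
Qed.

Lemma add_ribbonE p lam mu : shift p lam mu -> add_ribbon p lam = mu.
Proof. by move=> s; apply: (shift_funl (add_ribbonP (shift_addable s)) s). Qed.

Lemma del_ribbonE p lam mu : shift p lam mu -> del_ribbon p mu = lam.
Proof. by move=> s; apply: (shift_funr (del_ribbonP (shift_removable s)) s). Qed.

Lemma skewE lam mu i j : skew lam mu (i, j) <->
  (dg lam (j%:Z - i%:Z) <= i < dg mu (j%:Z - i%:Z))%N.
Proof.
split=> [[/in_diagram lt_i nl]|/andP[le_i lt_i]].
  by rewrite lt_i andbT leqNgt; apply/negP => /in_diagram.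
split; first exact/in_diagram.
by move/in_diagram; rewrite ltnNge le_i.
Qed.

Lemma subset_dg lam mu : (diagram lam `<=` diagram mu)%classic <->
  forall k, (dg lam k <= dg mu k)%N.
Proof.
split=> [sub k|le_dg [i j] /in_diagram lt_i]; last first.
  by apply/in_diagram; have := le_dg (j%:Z - i%:Z); lia.
rewrite leqNgt; apply/negP => lt_k.
have ge_k := dg_ge mu k; pose j := `|((dg mu k)%:Z + k)%R|%N.
have jE : j%:Z - (dg mu k)%:Z = k by rewrite /j; lia.
have /sub/in_diagram : diagram lam (dg mu k, j) by apply/in_diagram; rewrite jE.
by rewrite jE ltnn.
Qed.

(** The first square of the diagonal d_k outside [lam]; the absolute value is harmless by
    [dg_ge]. *)
Definition skew_square lam k : square := (dg lam k, `|((dg lam k)%:Z + k)%R|%N).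

Lemma skew_squareK lam k : diag (skew_square lam k) = k.
Proof. by rewrite /diag /skew_square /=; have := dg_ge lam k; lia. Qed.

Lemma skew_shift p lam mu s : shift p lam mu ->
  skew lam mu s <-> s = skew_square lam (diag s) /\ p <= diag s < p + r%:Z.
Proof.
move=> sh; case: s => i j; rewrite skewE sh /skew_square /diag /=.
have := dg_ge lam (j%:Z - i%:Z); move: (dg lam _) => d ge_d.
split=> [H|[[id ij] H]]; last by lia.
by split; [congr pair|]; lia.
Qed.

Lemma ribbon_shift lam mu : ribbon r lam mu <-> exists p, shift p lam mu.
Proof.
split=> [[/subset_dg le_dg [p [fun_d inj_d sur_d]]]|[p sh]].
  exists p => k; have ge_k := dg_ge lam k.
  have sk i : (dg lam k <= i < dg mu k)%N ->
      skew lam mu (i, `|(i%:Z + k)%R|%N) /\ diag (i, `|(i%:Z + k)%R|%N) = k.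
    move=> lt_i; have e : `|(i%:Z + k)%R|%N%:Z - i%:Z = k by lia.
    by rewrite skewE /diag /= e; split=> //; lia.
  case: (boolP (p <= k < p + r%:Z)) => k_in.
    have [[i j] /skewE sij dij] := sur_d k k_in.
    move: dij sij; rewrite /diag /= => -> sij.
    (* Growth by two or more would put two squares on the diagonal d_k, against injectivity. *)
    have := le_dg k; case: (ltnP (dg lam k).+1 (dg mu k)) => [lt_k|]; last lia.
    have [|s1 d1] := sk (dg lam k); first lia.
    have [|s2 d2] := sk (dg lam k).+1; first lia.
    have := inj_d _ _ (mem_set s1) (mem_set s2); rewrite d1 d2 => /(_ erefl) [].
    by lia.
  have := le_dg k; case: (ltnP (dg lam k) (dg mu k)) => [lt_k|]; last lia.
  have [|s1 d1] := sk (dg lam k); first lia.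
  by have := fun_d _ s1; rewrite /= d1 (negbTE k_in).
split; first by apply/subset_dg => k; rewrite sh; lia.
exists p; split=> [s /(skew_shift s sh) [] //|s s'|k k_in].
  rewrite !inE => /(skew_shift s sh) [-> _] /(skew_shift s' sh) [-> _].
  by rewrite !skew_squareK => ->.
exists (skew_square lam k); last exact: skew_squareK.
by apply/(skew_shift _ sh); rewrite skew_squareK.
Qed.

(** Along the ribbon, as the diagonal k increases, the row [dg lam k] weakly decreases and the
    column [dg lam k + k] weakly increases; the last diagonal thus carries the head. *)
Lemma head_shift p lam mu : shift p lam mu ->
  diag (head_square lam mu) = p + r%:Z - 1.
Proof.
move=> sh; rewrite /head_square; set A := (X in xget _ X).
suff -> : xget (0%N, 0%N) A = skew_square lam (p + r%:Z - 1) by exact: skew_squareK.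
have A0 : A (skew_square lam (p + r%:Z - 1)).
  split; first by apply/(skew_shift _ sh); rewrite skew_squareK; split=> //; lia.
  move=> s' /(skew_shift s' sh) [-> ]; rewrite skew_squareK => k_in /=.
  have le_k : diag s' <= p + r%:Z - 1 by lia.
  have := dg_mono lam le_k; have := dg_lip lam le_k.
  by have := dg_ge lam (diag s'); have := dg_ge lam (p + r%:Z - 1); lia.
have := @xgetPex _ (0%N, 0%N) A (ex_intro _ _ A0); case: (xget _ A) => i j [Ax minx].
case: A0 => [As mins]; have := minx _ As; have := mins _ Ax; rewrite /=.
by move=> H1 H2; apply/pair_equal_spec; lia.
Qed.

(** By [dg_ivt] the rows met are all those from [dg lam (p + r - 1)] to [dg lam p]. *)
Lemma height_shift p lam mu : shift p lam mu -> height lam mu = ribbon_height p lam.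
Proof.
move=> sh; rewrite /height /ribbon_height.
set a := dg lam (p + r%:Z - 1); set b := dg lam p.
have le_ab : (a <= b)%N by apply: dg_mono; lia.
have [n n_eq] : exists n, n = (b - a).+1 by eexists.
have -> : [set s.1 | s in skew lam mu]%classic = [set` iota a n]%classic.
  apply/seteqP; split=> i /=; rewrite mem_iota.
    move=> [s /(skew_shift s sh) [-> k_in] <-] /=; rewrite skew_squareK in k_in.
    have := @dg_mono lam p (diag s); have := @dg_mono lam (diag s) (p + r%:Z - 1).
    by rewrite -/a -/b; lia.
  move=> i_in; have [||k k_in <-] := @dg_ivt lam p (p + r%:Z - 1) i; [lia|rewrite -/a -/b; lia|].
  exists (skew_square lam k) => //; apply/(skew_shift _ sh).
  by rewrite skew_squareK; split=> //; lia.
rewrite (_ : [set` iota a n]%classic = [set` [fset x in iota a n]%fset]%classic); last first.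
  by apply/seteqP; split=> i /=; rewrite in_fset.
by rewrite set_fsetK card_fseq undup_id ?iota_uniq ?size_iota ?n_eq //=.
Qed.

Definition squares lam : seq square :=
  [seq (i, j) | i <- iota 0 (size lam), j <- iota 0 (nth 0%N lam i)].

Lemma size_squares lam : size (squares lam) = psize lam.
Proof.
rewrite size_allpairs_dep /psize; congr sumn.
under eq_map => i do rewrite size_iota.
by rewrite -[LHS]/(mkseq _ _) mkseq_nth.
Qed.

Lemma squares_uniq lam : uniq (squares lam).
Proof.
apply: allpairs_uniq_dep => [||[i j] [i' j'] _ _ /= [-> ->] //]; first exact: iota_uniq.
by move=> i _; exact: iota_uniq.
Qed.

Lemma mem_squares lam i j : ((i, j) \in squares lam) = (i < dg lam (j%:Z - i%:Z))%N.
Proof.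
have -> : (i < dg lam (j%:Z - i%:Z))%N = (j < nth 0%N lam i)%N by rewrite dgP; lia.
apply/allpairsPdep/idP => [[i' [j' [_ + [-> ->]]]]|lt_j].
  by rewrite mem_iota.
exists i, j; rewrite !mem_iota; split=> //.
by rewrite /= add0n -nth_intpart_gt0; lia.
Qed.

(** The size sums over rows whereas [shift] speaks of diagonals; listing the squares relates the
    two. *)
Lemma psize_shift p lam mu : shift p lam mu -> psize mu = (psize lam + r)%N.
Proof.
move=> sh; pose rib := [seq skew_square lam (p + n%:Z) | n <- iota 0 r].
have rib_mem s : (s \in rib) = `[< skew lam mu s >].
  apply/mapP/asboolP => [[n + ->]|/(skew_shift s sh) [eq_s k_in]].
    rewrite mem_iota => n_in; apply/(skew_shift _ sh); rewrite skew_squareK.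
    by split=> //; lia.
  exists `|(diag s - p)%R|%N; first by rewrite mem_iota; lia.
  by rewrite {1}eq_s; congr skew_square; lia.
suff /perm_size : perm_eq (squares mu) (squares lam ++ rib).
  by rewrite size_cat !size_squares size_map size_iota.
apply: uniq_perm; first exact: squares_uniq.
  rewrite cat_uniq squares_uniq /=; apply/andP; split.
    apply/hasPn => -[i j]; rewrite rib_mem => /asboolP/skewE.
    by rewrite mem_squares -leqNgt => /andP[].
  rewrite map_inj_in_uniq ?iota_uniq // => n n' _ _ /(congr1 diag).
  by rewrite !skew_squareK; lia.
move=> [i j]; rewrite mem_cat rib_mem !mem_squares.
have -> : `[< skew lam mu (i, j) >] =
    (dg lam (j%:Z - i%:Z) <= i < dg mu (j%:Z - i%:Z))%N.
  by apply/asboolP/idP => /skewE.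
have := sh (j%:Z - i%:Z); lia.
Qed.

End Ribbons.

(** * Sequences and windows of integers *)

Lemma pairmap_rcons (S T : Type) (g : S -> S -> T) x s y :
  pairmap g x (rcons s y) = rcons (pairmap g x s) (g (last x s) y).
Proof. by rewrite -!cats1 pairmap_cat. Qed.

Lemma uniq_fst (S T : eqType) (s : seq (S * T)) x y z : uniq [seq u.1 | u <- s] ->
  (x, y) \in s -> (x, z) \in s -> y = z.
Proof.
elim: s => //= -[x' y'] s IH /= /andP[nin un]; rewrite !inE !xpair_eqE.
have notin w : (x', w) \notin s by apply: contra nin => w_in; apply/mapP; exists (x', w).
case/orP=> [/andP[/eqP ex /eqP ->]|y_in]; case/orP=> [/andP[/eqP ex' /eqP ->]|z_in] //.
- by move: (notin z); rewrite -ex z_in.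
- by move: (notin y); rewrite -ex' y_in.
- exact: IH y_in z_in.
Qed.

Lemma sorted_subseq (s1 s2 : seq int) : sorted <%R s1 -> sorted <%R s2 ->
  {subset s1 <= s2} -> subseq s1 s2.
Proof.
move=> srt1 srt2 sub; have -> : s1 = [seq z <- s2 | z \in s1]; last exact: filter_subseq.
apply: lt_sorted_eq => //; first by apply: sorted_filter => //; exact: lt_trans.
by move=> z; rewrite mem_filter; case: (boolP (z \in s1)) => //= /sub.
Qed.

Definition window (a : int) n : seq int := [seq a + i%:Z | i <- iota 0 n].

Lemma windowS a n : window a n.+1 = a :: window (a + 1) n.
Proof.
rewrite /window /= addr0 -[1%N]/(1 + 0)%N iotaDl -map_comp; congr (_ :: _).
by apply: eq_map => i /=; lia.
Qed.

Lemma mem_window a n p : (p \in window a n) = (a <= p < a + n%:Z).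
Proof.
apply/mapP/idP => [[i + ->]|p_in]; first by rewrite mem_iota; lia.
by exists `|(p - a)%R|%N; rewrite ?mem_iota; lia.
Qed.

Lemma window_sorted a n : sorted <%R (window a n).
Proof.
by rewrite /window sorted_map; apply: sub_sorted (iota_ltn_sorted 0 n) => i j /=; lia.
Qed.

(** * Commutation of the local operators *)

Section Commutation.
Variables (r : nat) (r_gt0 : (0 < r)%N).
Implicit Types (lam mu kap om : intpart) (p : int).

Lemma shift_height p lam mu : shift r p lam mu ->
  ribbon_height r p mu = ribbon_height r p lam.
Proof.
by move=> sh; rewrite /ribbon_height; have := sh p; have := sh (p + r%:Z - 1); lia.
Qed.

Lemma addableN p lam : addable r p lam -> ~~ removable r p lam.
Proof. by case/andP=> lt_p _; apply/negP => /andP[_]; lia. Qed.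

Lemma shift_down p p' lam mu kap : p != p' -> shift r p lam mu -> shift r p' kap mu ->
  exists2 om, shift r p' om lam & shift r p om kap.
Proof.
move=> ne_p sh sh'; have /andP[a1 a2] := shift_addable r_gt0 sh.
have /andP[b1 b2] := shift_removable r_gt0 sh'.
have rem : removable r p' lam.
  rewrite /removable; have := sh (p' + r%:Z); have := sh (p' + r%:Z - 1).
  have := sh (p' - 1); have := sh p'.
  have := dg_step lam p'; have := dg_step lam (p' + r%:Z).
  move/eqP: a2 => a2; move/eqP: b2 => b2.
  (* Neither coincidence, p' + r = p or p' = p + r, can occur: the common position would be both
     occupied and free in [mu]. *)
  have [e|ne1] := eqVneq (p' + r%:Z) p; first by rewrite e; lia.
  have [e|ne2] := eqVneq p' (p + r%:Z); last by lia.
  by subst p'; lia.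
have sh2 := del_ribbonP r_gt0 rem; exists (del_ribbon r p' lam) => // k.
by have := sh2 k; have := sh k; have := sh' k; lia.
Qed.

Lemma shift_up p p' om lam kap : p != p' -> shift r p' om lam -> shift r p om kap ->
  exists2 mu, shift r p lam mu & shift r p' kap mu.
Proof.
move=> ne_p sh sh'; have /andP[a1 /eqP a2] := shift_addable r_gt0 sh.
have /andP[b1 /eqP b2] := shift_addable r_gt0 sh'.
have add : addable r p lam.
  rewrite /addable; have := sh (p + r%:Z); have := sh (p + r%:Z - 1).
  have := sh (p - 1); have := sh p.
  by have := dg_step lam p; have := dg_step lam (p + r%:Z); lia.
have sh2 := add_ribbonP r_gt0 add; exists (add_ribbon r p lam) => // k.
by have := sh2 k; have := sh k; have := sh' k; lia.
Qed.

(** If p < p' < p + r, moving the bead p' takes one bead out of the interval (p, p + r), while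
    moving the bead p brings one into (p', p' + r): the two changes cancel. The case p' < p < p' + r
    is symmetric. *)
Lemma shift_height_square p p' om lam kap mu : p != p' ->
  shift r p' om lam -> shift r p om kap -> shift r p lam mu -> shift r p' kap mu ->
  (ribbon_height r p lam + ribbon_height r p' mu =
   ribbon_height r p' lam + ribbon_height r p kap)%N.
Proof.
move=> ne_p s1 s2 s3 s4; rewrite /ribbon_height.
have m1 : (dg mu (p' + r%:Z - 1) <= dg mu p')%N by apply: dg_mono; lia.
have m2 : (dg lam (p' + r%:Z - 1) <= dg lam p')%N by apply: dg_mono; lia.
have m3 : (dg lam (p + r%:Z - 1) <= dg lam p)%N by apply: dg_mono; lia.
have m4 : (dg kap (p + r%:Z - 1) <= dg kap p)%N by apply: dg_mono; lia.
have := s3 p'; have := s3 (p' + r%:Z - 1).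
have := s1 p; have := s1 (p + r%:Z - 1); have := s2 p; have := s2 (p + r%:Z - 1).
by lia.
Qed.

Variables (R : comNzRingType) (t x y : R).
Implicit Type f : intpart -> R.

(** This is A_p, and [del_op] is B_p, with t, x, y in the roles of q^(1/2), X, Y. *)
Definition add_op p f lam : R :=
  f lam + (if addable r p lam
           then x * t ^+ ribbon_height r p lam * f (add_ribbon r p lam) else 0).

Definition del_op p f lam : R :=
  f lam + (if removable r p lam
           then y * t ^+ ribbon_height r p lam * f (del_ribbon r p lam) else 0).

Lemma add_del_op p p' f : p != p' -> add_op p (del_op p' f) = del_op p' (add_op p f).
Proof.
move=> ne_p; apply/funext => lam; rewrite /add_op /del_op.
have key : (if addable r p lam then if removable r p' (add_ribbon r p lam) then
      x * t ^+ ribbon_height r p lam * (y * t ^+ ribbon_height r p' (add_ribbon r p lam)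
        * f (del_ribbon r p' (add_ribbon r p lam))) else 0 else 0) =
    (if removable r p' lam then if addable r p (del_ribbon r p' lam) then
      y * t ^+ ribbon_height r p' lam * (x * t ^+ ribbon_height r p (del_ribbon r p' lam)
        * f (add_ribbon r p (del_ribbon r p' lam))) else 0 else 0).
  case: ifPn => [/(add_ribbonP r_gt0) sh|na].
    case: ifPn => [/(del_ribbonP r_gt0) sh'|nr].
      have [om so so'] := shift_down ne_p sh sh'.
      rewrite (shift_removable r_gt0 so) (del_ribbonE r_gt0 so) (shift_addable r_gt0 so').
      rewrite (add_ribbonE r_gt0 so').
      have := shift_height_square ne_p so so' sh sh'.
      rewrite (shift_height so') => e.
      have monM (u v : R) m n w : u * t ^+ m * (v * t ^+ n * w) = u * v * t ^+ (m + n) * w.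
        by rewrite exprD; ring.
      by rewrite !monM e [y * x]mulrC.
    case: ifPn => // /(del_ribbonP r_gt0) so; case: ifPn => // /(add_ribbonP r_gt0) so'.
    have [mu s1 s2] := shift_up ne_p so so'.
    by move: nr; rewrite (add_ribbonE r_gt0 s1) (shift_removable r_gt0 s2).
  case: ifPn => // /(del_ribbonP r_gt0) so; case: ifPn => // /(add_ribbonP r_gt0) so'.
  have [mu s1 s2] := shift_up ne_p so so'.
  by move: na; rewrite (shift_addable r_gt0 s1).
have ifD (b : bool) (u v w : R) :
    (if b then u * (v + w) else 0) = (if b then u * v else 0) + (if b then u * w else 0).
  by case: b; rewrite ?mulrDr ?addr0.
rewrite !ifD -!addrA; congr (_ + _).
have ifM (b b' : bool) (u w : R) : (if b then u * (if b' then w else 0) else 0) =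
    (if b then if b' then u * w else 0 else 0).
  by case: b => //; case: b' => //; rewrite mulr0.
by rewrite !ifM key addrCA.
Qed.

Definition gauge_weight c : R := \prod_(c <= i < r) (1 + t ^+ (2 * i) * x * y).

(** This is W_p: the difference of the two [dg] counts the beads in [p, p + r). *)
Definition gauge p f lam : R :=
  gauge_weight (dg lam (p - 1) - dg lam (p + r%:Z - 1)) * f lam.

Lemma gauge_weightS c : (c < r)%N ->
  gauge_weight c = (1 + t ^+ (2 * c) * x * y) * gauge_weight c.+1.
Proof. by move=> lt_c; rewrite /gauge_weight big_ltn. Qed.

(** If exactly one of p and p + r is occupied, with h beads strictly between, then moving the bead
    there and back contributes 1 + t^(2h) x y. The bead counts of the windows at p and p + 1 are h +
    1 and h, in one order or the other, so this is the factor by which their gauges differ. If both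
    or neither are occupied, no move is possible and the two counts agree. *)
Lemma gauge_add_del p f :
  gauge p (add_op p (del_op p f)) = del_op p (add_op p (gauge (p + 1) f)).
Proof.
apply/funext => lam; rewrite /gauge.
have -> : p + 1 - 1 = p by lia.
have -> : p + 1 + r%:Z - 1 = p + r%:Z by lia.
have m : (dg lam (p + r%:Z - 1) <= dg lam p)%N by apply: dg_mono; lia.
have st := dg_step lam p; have st' := dg_step lam (p + r%:Z).
(* Only r - 1 positions lie strictly between p and p + r, so h < r and [gauge_weightS] applies at
   h. *)
have lip : (dg lam p < dg lam (p + r%:Z - 1) + r)%N.
  by have := @dg_lip lam p (p + r%:Z - 1); lia.
rewrite /add_op /del_op; case: (boolP (addable r p lam)) => [add|nadd].
  rewrite (negbTE (addableN add)) !addr0.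
  have sh := add_ribbonP r_gt0 add; rewrite (shift_removable r_gt0 sh) (del_ribbonE r_gt0 sh).
  rewrite (shift_height sh) (sh p) (sh (p + r%:Z)).
  case/andP: add => a1 /eqP a2.
  set h := ribbon_height r p lam.
  have -> : (dg lam (p - 1) - dg lam (p + r%:Z - 1))%N = h.+1.
    by rewrite /h /ribbon_height; lia.
  have -> : (dg lam p - dg lam (p + r%:Z))%N = h by rewrite /h /ribbon_height; lia.
  have -> : (dg lam p + (p <= p < p + r%:Z)%R -
      (dg lam (p + r%:Z) + (p <= p + r%:Z < p + r%:Z)%R))%N = h.+1.
    by rewrite /h /ribbon_height; lia.
  rewrite (@gauge_weightS h); last by rewrite /h /ribbon_height; lia.
  rewrite mul2n -addnn exprD.
  by ring.
have [a1 a2] := conj (dg_step lam p) (dg_step lam (p + r%:Z)).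
case: (boolP (removable r p lam)) => [rem|nrem]; last first.
  rewrite !addr0; congr (gauge_weight _ * _).
  by move: nadd nrem; rewrite /addable /removable; lia.
have sh := del_ribbonP r_gt0 rem; rewrite (shift_addable r_gt0 sh) (add_ribbonE r_gt0 sh).
rewrite -(shift_height sh) addr0.
case/andP: rem => b1 /eqP b2; set h := ribbon_height r p lam.
have -> : (dg lam (p - 1) - dg lam (p + r%:Z - 1))%N = h.
  by rewrite /h /ribbon_height; lia.
have -> : (dg lam p - dg lam (p + r%:Z))%N = h.+1 by rewrite /h /ribbon_height; lia.
have -> : (dg (del_ribbon r p lam) p - dg (del_ribbon r p lam) (p + r%:Z))%N = h.
  by have := sh p; have := sh (p + r%:Z); rewrite /h /ribbon_height; lia.
rewrite (@gauge_weightS h); last by rewrite /h /ribbon_height; lia.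
by rewrite mul2n -addnn exprD; ring.
Qed.

Lemma foldr_add_del p ps f : p \notin ps ->
  foldr add_op (del_op p f) ps = del_op p (foldr add_op f ps).
Proof.
elim: ps => //= p' ps IH; rewrite inE negb_or => /andP[ne_p nin].
by rewrite IH // add_del_op // eq_sym.
Qed.

Lemma add_foldr_del p ps f : p \notin ps ->
  add_op p (foldr del_op f ps) = foldr del_op (add_op p f) ps.
Proof.
elim: ps => //= p' ps IH; rewrite inE negb_or => /andP[ne_p nin].
by rewrite -IH // add_del_op.
Qed.

(** B_a is moved left past the A_p with p > a, [gauge_add_del] turns W_a A_a B_a into B_a A_a
    W_(a+1), induction carries W_(a+1) to the right end, and A_a is moved right past the remaining
    B_p. *)
Lemma gauge_window a n f :
  gauge a (foldr add_op (foldr del_op f (window a n)) (window a n)) =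
  foldr del_op (foldr add_op (gauge (a + n%:Z) f) (window a n)) (window a n).
Proof.
elim: n a => [|n IH] a; first by rewrite addr0.
have nin : a \notin window (a + 1) n by rewrite mem_window; lia.
rewrite windowS /= foldr_add_del // gauge_add_del IH -add_foldr_del //.
by have -> : a + 1 + n%:Z = a + n.+1%:Z by lia.
Qed.

End Commutation.

(** * Enumeration of chains of moves at increasing positions *)

Section StripList.
Variables (ok : int -> intpart -> bool) (mv : int -> intpart -> intpart).
Variable ht : int -> intpart -> nat.

(* The ends of the chains that perform moves at increasing positions among ps,
   each with the sum of the heights and the number of the moves. *)
Fixpoint move_list (ps : seq int) (lam : intpart) : seq (intpart * (nat * nat)) :=
  if ps is p :: ps' then
    move_list ps' lam ++
    (if ok p lam then
       [seq (s.1, (ht p lam + s.2.1, s.2.2.+1)%N) | s <- move_list ps' (mv p lam)]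
     else [::])
  else [:: (lam, (0, 0)%N)].

(** Expanding the product of operators chooses at each position whether to move; [add_op] and
    [del_op] are both instances of the function folded here. *)
Lemma foldr_move_op (R : comNzRingType) (t x : R) ps (f : intpart -> R) lam :
  foldr (fun p f lam =>
      f lam + (if ok p lam then x * t ^+ ht p lam * f (mv p lam) else 0)) f ps lam =
  \sum_(s <- move_list ps lam) x ^+ s.2.2 * t ^+ s.2.1 * f s.1.
Proof.
elim: ps lam => [|p ps IH] lam /=; first by rewrite big_seq1 !expr0 !mul1r.
rewrite big_cat -IH; congr (_ + _); case: ifP => _; last by rewrite big_nil.
rewrite big_map IH mulr_sumr; apply: eq_bigr => s _ /=.
by rewrite exprS exprD; ring.
Qed.

Hypothesis mv_low : forall p lam k, ok p lam -> k < p -> dg (mv p lam) k = dg lam k.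
Hypothesis mv_neq : forall p lam, ok p lam -> dg (mv p lam) p != dg lam p.

Lemma move_list_low ps lam s k : s \in move_list ps lam -> {in ps, forall p, k < p} ->
  dg s.1 k = dg lam k.
Proof.
elim: ps lam s => [|p ps IH] lam s /=; first by rewrite inE => /eqP ->.
move=> + lt_k; have lt_k' : {in ps, forall p, k < p}.
  by move=> p' p'_in; apply: lt_k; rewrite inE p'_in orbT.
rewrite mem_cat => /orP[/IH -> //|]; case: ifP => // okp /mapP[s' /IH s'E -> /=].
by rewrite s'E // mv_low //; apply: lt_k; rewrite inE eqxx.
Qed.

(** The end of a chain determines its moves: [dg] at the first position p changes exactly when the
    move at p is made, because later moves leave it alone. This underlies the uniqueness of
    standardisations. *)
Lemma move_list_uniq ps lam : sorted <%R ps -> uniq [seq s.1 | s <- move_list ps lam].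
Proof.
elim: ps lam => //= p ps IH lam; rewrite (path_sortedE lt_trans) => /andP[/allP lt_p srt].
rewrite map_cat cat_uniq IH //=; case: ifP => //= okp.
rewrite -map_comp (eq_map (_ : fst \o _ =1 fst)) // IH // andbT.
apply/hasPn => _ /mapP[s s_in ->]; apply/mapP => -[s' s'_in e].
have := mv_neq okp; rewrite -(move_list_low s_in lt_p) e (move_list_low s'_in lt_p).
by rewrite eqxx.
Qed.

End StripList.

(** * Ribbon strips as entries of these lists *)

Section Strips.
Variables (r : nat) (r_gt0 : (0 < r)%N).
Implicit Types (lam mu nu kap : intpart) (p k : int) (c : seq intpart).

Definition add_list := move_list (addable r) (add_ribbon r) (ribbon_height r).
(** The positions increase here too: a vertical chain has decreasing heads, so read from its top
    down it loses ribbons with increasing heads. *)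
Definition del_list := move_list (removable r) (del_ribbon r) (ribbon_height r).

Lemma add_list_uniq ps lam : sorted <%R ps -> uniq [seq s.1 | s <- add_list ps lam].
Proof.
apply: move_list_uniq => [p {}lam k|p {}lam] /(add_ribbonP r_gt0) sh; rewrite sh; lia.
Qed.

Lemma del_list_uniq ps lam : sorted <%R ps -> uniq [seq s.1 | s <- del_list ps lam].
Proof.
apply: move_list_uniq => [p {}lam k|p {}lam] /(del_ribbonP r_gt0) sh.
  by have := sh k; lia.
by have := sh p; lia.
Qed.

Definition heads (ps : seq int) : seq int := [seq p + r%:Z - 1 | p <- ps].

Lemma ribbonP lam mu : reflect (exists p, shift r p lam mu) `[< ribbon r lam mu >].
Proof. by apply: (iffP (asboolP _)) => /(ribbon_shift r_gt0). Qed.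

Lemma add_listP ps lam mu h n :
  (mu, (h, n)) \in add_list ps lam <->
  exists c, [/\ ribbon_chain r lam mu c, subseq (head_diags lam c) (heads ps),
                chain_height lam c = h & size c = n].
Proof.
elim: ps lam mu h n => [|p ps IH] lam mu h n /=.
  rewrite inE; split=> [/eqP[-> -> ->]|[[|lam' c] [[_ /= <-] //= _ <- <-] //]].
  by exists [::].
rewrite mem_cat; split.
  case/orP=> [/IH[c [ch sub hh sz]]|].
    by exists c; split=> //; apply: subseq_trans sub (subseq_cons _ _).
  case: ifP => // add /mapP[[mu' [h' n']] /IH[c [[ch lc] sub hh sz]] [-> -> ->]].
  have sh := add_ribbonP r_gt0 add.
  exists (add_ribbon r p lam :: c); split.
  - by split=> //=; rewrite ch andbT; apply/ribbonP; exists p.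
  - by rewrite /head_diags /= (head_shift r_gt0 sh) eqxx.
  - by rewrite /chain_height /= (height_shift r_gt0 sh) -hh.
  - by rewrite /= sz.
case=> -[|lam' c] [[/= ch lc] sub hh sz].
  by apply/orP; left; apply/IH; exists [::]; split=> //; exact: sub0seq.
case/andP: ch => /ribbonP[p' sh] ch; move: sub hh.
rewrite /head_diags /chain_height /= (head_shift r_gt0 sh) (height_shift r_gt0 sh) => sub hh.
apply/orP; move: sub; case: eqP => [e|_] sub; last first.
  left; apply/IH; exists (lam' :: c); split=> //.
  - by split=> //=; rewrite ch andbT; apply/ribbonP; exists p'.
  - by rewrite /head_diags /= (head_shift r_gt0 sh).
  - by rewrite /chain_height /= (height_shift r_gt0 sh).
have {}e : p' = p by lia.
subst p'; right; rewrite (shift_addable r_gt0 sh) (add_ribbonE r_gt0 sh); apply/mapP.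
exists (mu, (chain_height lam' c, size c)); last by rewrite /= -hh -sz.
by apply/IH; exists c.
Qed.

Lemma del_listP ps lam mu h n :
  (lam, (h, n)) \in del_list ps mu <->
  exists c, [/\ ribbon_chain r lam mu c, subseq (rev (head_diags lam c)) (heads ps),
                chain_height lam c = h & size c = n].
Proof.
elim: ps lam mu h n => [|p ps IH] lam mu h n /=.
  rewrite inE; split=> [/eqP[-> -> ->]|]; first by exists [::].
  case=> c [[_ <-] + <- <-]; case: c => [|lam' c] //= /eqP.
  by move/(congr1 size); rewrite size_rev.
rewrite mem_cat; split.
  case/orP=> [/IH[c [ch sub hh sz]]|].
    by exists c; split=> //; apply: subseq_trans sub (subseq_cons _ _).
  case: ifP => // rem /mapP[[lam' [h' n']] /IH[c [[ch lc] sub hh sz]] [-> -> ->]].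
  rewrite /= in ch lc sub hh sz *.
  have sh := del_ribbonP r_gt0 rem.
  exists (rcons c mu); split.
  - split; last by rewrite last_rcons.
    by rewrite rcons_path ch lc; apply/ribbonP; exists p.
  - by rewrite /head_diags pairmap_rcons rev_rcons lc (head_shift r_gt0 sh) /= eqxx.
  - rewrite /chain_height pairmap_rcons sumn_rcons lc (height_shift r_gt0 sh).
    by rewrite -/(chain_height _ _) hh (shift_height r_gt0 sh) addnC.
  - by rewrite size_rcons sz.
case=> c; case/lastP: c => [|c mu'] [[ch lc] sub hh sz].
  by apply/orP; left; apply/IH; exists [::]; split=> //; exact: sub0seq.
rewrite last_rcons in lc; subst mu'; move: (ch).
rewrite rcons_path => /andP[ch' /ribbonP[p' sh]]; move: (sub) (hh).
rewrite /head_diags /chain_height !pairmap_rcons rev_rcons sumn_rcons.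
rewrite (head_shift r_gt0 sh) (height_shift r_gt0 sh) /= => sub' hh'.
apply/orP; move: sub'; case: eqP => [e|ne] sub'; last first.
  left; apply/IH; exists (rcons c mu); split=> //; first by rewrite /ribbon_chain last_rcons.
  by rewrite /head_diags pairmap_rcons rev_rcons (head_shift r_gt0 sh).
have {}e : p' = p by lia.
subst p'; right; rewrite (shift_removable r_gt0 sh) (del_ribbonE r_gt0 sh); apply/mapP.
exists (lam, (chain_height lam c, size c)).
  by apply/IH; exists c.
by rewrite /= (shift_height r_gt0 sh) -hh' -sz size_rcons addnC.
Qed.

Lemma chain_dg lam c k : path (fun x y => `[< ribbon r x y >]) lam c ->
  (dg lam k <= dg (last lam c) k)%N.
Proof.
elim: c lam => //= lam' c IH lam /andP[/ribbonP[p sh] /IH].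
by have := sh k; lia.
Qed.

(** The ribbon with head on d_d is a bead move from d - r + 1. It increases [dg] there, and no other
    step of the chain decreases it. *)
Lemma chain_heads lam c d : path (fun x y => `[< ribbon r x y >]) lam c ->
  d \in head_diags lam c ->
  (dg lam (d - r%:Z + 1) < dg (last lam c) (d - r%:Z + 1))%N.
Proof.
elim: c lam => //= lam' c IH lam /andP[/ribbonP[p sh] ch].
rewrite /head_diags /= (head_shift r_gt0 sh) inE.
have s := sh (d - r%:Z + 1); have le_c := chain_dg (d - r%:Z + 1) ch.
by case/orP=> [/eqP ed|/(IH _ ch)]; lia.
Qed.

Lemma chain_size lam c : path (fun x y => `[< ribbon r x y >]) lam c ->
  psize (last lam c) = (psize lam + size c * r)%N.
Proof.
elim: c lam => [|lam' c IH] lam /=; first by rewrite addn0.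
by case/andP=> /ribbonP[p /(psize_shift r_gt0) sz] /IH ->; rewrite sz; lia.
Qed.

Lemma heads_sub lam mu c a n : ribbon_chain r lam mu c ->
  (forall p, (dg lam p < dg mu p)%N -> a <= p < a + n%:Z) ->
  {subset head_diags lam c <= heads (window a n)}.
Proof.
move=> [ch lc] bnd d /(chain_heads ch); rewrite lc => /bnd d_in.
apply/mapP; exists (d - r%:Z + 1); rewrite ?mem_window //; lia.
Qed.

Lemma heads_sorted a n : sorted <%R (heads (window a n)).
Proof.
by rewrite /heads sorted_map; apply: sub_sorted (window_sorted a n) => i j /=; lia.
Qed.

Lemma hstandard_add_list lam mu c a n : hstandard r lam mu c ->
  (forall p, (dg lam p < dg mu p)%N -> a <= p < a + n%:Z) ->
  (mu, (chain_height lam c, size c)) \in add_list (window a n) lam.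
Proof.
move=> [ch srt] bnd; apply/add_listP; exists c; split=> //.
by apply: sorted_subseq srt _ _; [exact: heads_sorted | exact: heads_sub ch bnd].
Qed.

Lemma vstandard_del_list lam mu c a n : vstandard r lam mu c ->
  (forall p, (dg lam p < dg mu p)%N -> a <= p < a + n%:Z) ->
  (lam, (chain_height lam c, size c)) \in del_list (window a n) mu.
Proof.
move=> [ch srt] bnd; apply/del_listP; exists c; split=> //.
apply: sorted_subseq; [by rewrite rev_sorted | exact: heads_sorted |].
by move=> d; rewrite mem_rev; exact: heads_sub ch bnd d.
Qed.

(** Two standardisations give entries of one [add_list] with the same end, so [add_list_uniq]
    equates their heights and the choice made by [xget] is immaterial. *)
Lemma dspinE lam mu c : hstandard r lam mu c -> dspin r lam mu = chain_height lam c.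
Proof.
move=> st; have st' := @xgetPex _ [::] _ (ex_intro _ c st).
have bnd p := @dg_bound lam mu _ p (leqnn _).
have := uniq_fst (add_list_uniq _ (window_sorted _ _))
  (hstandard_add_list st' bnd) (hstandard_add_list st bnd).
by case.
Qed.

Lemma dspintE lam mu c : vstandard r lam mu c -> dspint r lam mu = chain_height lam c.
Proof.
move=> st; have st' := @xgetPex _ [::] _ (ex_intro _ c st).
have bnd p := @dg_bound lam mu _ p (leqnn _).
have := uniq_fst (del_list_uniq _ (window_sorted _ _))
  (vstandard_del_list st' bnd) (vstandard_del_list st bnd).
by case.
Qed.

Lemma skew_rsizeE lam mu c : ribbon_chain r lam mu c ->
  psize mu = (psize lam + skew_rsize r lam mu * r)%N /\ skew_rsize r lam mu = size c.
Proof.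
move=> [ch lc]; have := chain_size ch; rewrite lc /skew_rsize => ->.
by rewrite addKn mulnK.
Qed.

Lemma hstrip_add_list lam mu a n : hstrip r lam mu ->
  (forall p, (dg lam p < dg mu p)%N -> a <= p < a + n%:Z) ->
  (mu, (dspin r lam mu, skew_rsize r lam mu)) \in add_list (window a n) lam.
Proof.
move=> [c st] bnd; have [_ ->] := skew_rsizeE st.1.
by rewrite (dspinE st); exact: hstandard_add_list.
Qed.

Lemma vstrip_del_list lam mu a n : vstrip r lam mu ->
  (forall p, (dg lam p < dg mu p)%N -> a <= p < a + n%:Z) ->
  (lam, (dspint r lam mu, skew_rsize r lam mu)) \in del_list (window a n) mu.
Proof.
move=> [c st] bnd; have [_ ->] := skew_rsizeE st.1.
by rewrite (dspintE st); exact: vstandard_del_list.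
Qed.

Lemma mem_add_list lam s a n : s \in add_list (window a n) lam ->
  hstrip r lam s.1 /\ s.2 = (dspin r lam s.1, skew_rsize r lam s.1).
Proof.
case: s => mu [h m] /add_listP[c [ch sub hh sz]] /=.
have st : hstandard r lam mu c.
  by split=> //; apply: (subseq_sorted lt_trans) sub (heads_sorted a n).
split; first by exists c.
by rewrite (dspinE st) hh; have [_ ->] := skew_rsizeE ch; rewrite sz.
Qed.

Lemma mem_del_list mu s a n : s \in del_list (window a n) mu ->
  vstrip r s.1 mu /\ s.2 = (dspint r s.1 mu, skew_rsize r s.1 mu).
Proof.
case: s => lam [h m] /del_listP[c [ch sub hh sz]] /=.
have st : vstandard r lam mu c.
  by split=> //; rewrite -rev_sorted; apply: (subseq_sorted lt_trans) sub (heads_sorted a n).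
split; first by exists c.
by rewrite (dspintE st) hh; have [_ ->] := skew_rsizeE ch; rewrite sz.
Qed.

Lemma hchain_low lam c d k : path (fun x y => `[< ribbon r x y >]) lam c ->
  path <%R d (head_diags lam c) -> k <= d - r%:Z + 1 -> dg (last lam c) k = dg lam k.
Proof.
elim: c lam d => //= lam' c IH lam d /andP[/ribbonP[p sh] ch].
rewrite /head_diags /= (head_shift r_gt0 sh) => /andP[lt_d srt] le_k.
by rewrite (IH _ _ ch srt); [rewrite sh; lia | lia].
Qed.

Lemma vchain_high lam c d k : path (fun x y => `[< ribbon r x y >]) lam c ->
  path >%R d (head_diags lam c) -> d <= k -> dg (last lam c) k = dg lam k.
Proof.
elim: c lam d => //= lam' c IH lam d /andP[/ribbonP[p sh] ch].
rewrite /head_diags /= (head_shift r_gt0 sh) => /andP[lt_d srt] le_k.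
by rewrite (IH _ _ ch srt); [rewrite sh; lia | lia].
Qed.

(** The first ribbon has the lowest head, and its bead must land on a place free in [lam]; all
    places up to -|lam| are occupied. *)
Lemma hstrip_low lam mu k : hstrip r lam mu -> k <= - (psize lam)%:Z - r%:Z ->
  dg mu k = dg lam k.
Proof.
move=> [[|lam' c] [[/= + <-] //]]; case/andP=> /ribbonP[p sh] ch.
rewrite /head_diags /= (head_shift r_gt0 sh) => srt le_k.
have /andP[_ /eqP a2] := shift_addable r_gt0 sh.
have lt_p : - (psize lam)%:Z < p + r%:Z.
  rewrite ltNge; apply/negP => le_p; have e1 := dg_low le_p.
  by have := @dg_low lam (p + r%:Z - 1); lia.
by rewrite (hchain_low ch srt); [rewrite sh; lia | lia].
Qed.

(** The first ribbon has the highest head, and it moves a bead of [lam], which lies at most at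
    |lam|. *)
Lemma vstrip_high lam mu k : vstrip r lam mu -> (psize lam)%:Z + r%:Z <= k ->
  dg mu k = dg lam k.
Proof.
move=> [[|lam' c] [[/= + <-] //]]; case/andP=> /ribbonP[p sh] ch.
rewrite /head_diags /= (head_shift r_gt0 sh) => srt le_k.
have /andP[a1 _] := shift_addable r_gt0 sh.
have lt_p : p - 1 < (psize lam)%:Z.
  by rewrite ltNge; apply/negP => /dg_high; lia.
by rewrite (vchain_high ch srt); [rewrite sh; lia | lia].
Qed.

(** The size of [kap] is not bounded in advance. The vertical strip over [mu] bounds the moves on
    the right and the horizontal strip over [nu] bounds them on the left. *)
Lemma top_bound mu nu kap N : vstrip r mu kap -> hstrip r nu kap ->
  (psize mu + psize nu + r <= N)%N ->
  forall p, (dg nu p < dg kap p)%N || (dg mu p < dg kap p)%N ->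
  - N%:Z <= p < - N%:Z + (N + N)%N%:Z.
Proof.
move=> vs hs le_N p lt_p; case: (leP N%:Z p) => [le_p|lt_pN].
  have := @vstrip_high mu kap p vs; have := @dg_high mu p; lia.
case: (leP p (- N%:Z)) => [le_p|]; last lia.
have := @hstrip_low nu kap p hs; have := @dg_low nu p; have := dg_ge mu p.
by lia.
Qed.

End Strips.

(** * The identity between generating functions of strips *)

Section CauchyIdentity.
Variables (r : nat) (r_gt0 : (0 < r)%N).
Implicit Types lam mu nu kap : intpart.

Definition strip_window mu nu : seq int :=
  let N := (psize mu + psize nu + r)%N in window (- N%:Z) (N + N)%N.

Definition tops mu nu : seq intpart :=
  [seq s.1 | s <- add_list r (strip_window mu nu) nu & `[< vstrip r mu s.1 >]].

Definition bottoms mu nu : seq intpart :=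
  [seq s.1 | s <- del_list r (strip_window mu nu) nu & `[< hstrip r s.1 mu >]].

Lemma tops_uniq mu nu : uniq (tops mu nu).
Proof.
have /subseq_uniq : subseq (tops mu nu) [seq s.1 | s <- add_list r (strip_window mu nu) nu].
  by apply/map_subseq/filter_subseq.
by apply; apply: add_list_uniq r_gt0 _ _ (window_sorted _ _).
Qed.

Lemma bottoms_uniq mu nu : uniq (bottoms mu nu).
Proof.
have /subseq_uniq : subseq (bottoms mu nu) [seq s.1 | s <- del_list r (strip_window mu nu) nu].
  by apply/map_subseq/filter_subseq.
by apply; apply: del_list_uniq r_gt0 _ _ (window_sorted _ _).
Qed.

Lemma mem_tops mu nu kap : (kap \in tops mu nu) = `[< vstrip r mu kap /\ hstrip r nu kap >].
Proof.
apply/mapP/asboolP => [[s]|[vs hs]].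
  rewrite mem_filter => /andP[/asboolP vs s_in] ->.
  by have [] := mem_add_list r_gt0 s_in.
exists (kap, (dspin r nu kap, skew_rsize r nu kap)) => //.
rewrite mem_filter asboolT //=; apply: (hstrip_add_list r_gt0 hs) => p lt_p.
by apply: (top_bound r_gt0 vs hs) => //; rewrite lt_p.
Qed.

Lemma mem_bottoms mu nu lam :
  (lam \in bottoms mu nu) = `[< hstrip r lam mu /\ vstrip r lam nu >].
Proof.
apply/mapP/asboolP => [[s]|[hs vs]].
  rewrite mem_filter => /andP[/asboolP vs s_in] ->.
  by have [] := mem_del_list r_gt0 s_in.
exists (lam, (dspint r lam nu, skew_rsize r lam nu)) => //.
rewrite mem_filter asboolT //=; apply: (vstrip_del_list r_gt0 vs) => p lt_p.
by apply: dg_bound lt_p; lia.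
Qed.

Variables (R : comNzRingType) (t x y : R).

Lemma big_pick (l : seq (intpart * (nat * nat))) (F : intpart * (nat * nat) -> R) mu v
    (P : bool) : uniq [seq s.1 | s <- l] -> (P -> (mu, v) \in l) ->
    {in l, forall s, s.1 = mu -> P} ->
  \sum_(s <- l) F s * (s.1 == mu)%:R = if P then F (mu, v) else 0.
Proof.
move=> un inP toP; case: (boolP P) => [/inP v_in|nP].
  rewrite (bigD1_seq (mu, v)) ?(map_uniq un) //= eqxx mulr1 big1_seq ?addr0 //.
  move=> [mu' v'] /andP[ne v'_in] /=; case: eqP => [e|]; last by rewrite mulr0.
  by case/eqP: ne; rewrite e in v'_in *; rewrite (uniq_fst un v_in v'_in).
rewrite big1_seq // => s /= s_in; case: eqP => [e|]; last by rewrite mulr0.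
by case/negP: nP; exact: toP s_in e.
Qed.

Definition mon (k : nat * (nat * nat)) : R := x ^+ k.1 * y ^+ k.2.1 * t ^+ k.2.2.

Definition top_key mu nu kap : nat * (nat * nat) :=
  (skew_rsize r nu kap, (skew_rsize r mu kap, (dspint r mu kap + dspin r nu kap)%N)).

Definition bottom_key mu nu lam : nat * (nat * nat) :=
  (skew_rsize r lam mu, (skew_rsize r lam nu, (dspin r lam mu + dspint r lam nu)%N)).

Let delta mu lam : R := (lam == mu)%:R.

(** A matrix coefficient of the operator product: the chains add ribbons from [nu] up to some [kap],
    then remove ribbons down to [mu]. *)
Lemma add_del_delta mu nu :
  foldr (add_op r t x) (foldr (del_op r t y) (delta mu) (strip_window mu nu))
    (strip_window mu nu) nu = \sum_(kap <- tops mu nu) mon (top_key mu nu kap).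
Proof.
rewrite (foldr_move_op (addable r) (add_ribbon r) (ribbon_height r)).
rewrite big_map big_filter [RHS]big_mkcond -/(add_list r _ _).
apply: eq_big_seq => s s_in; have [hs es] := mem_add_list r_gt0 s_in.
rewrite (foldr_move_op (removable r) (del_ribbon r) (ribbon_height r)) -/(del_list r _ _).
under eq_bigr => s' _ do rewrite /delta.
rewrite (@big_pick _ _ mu (dspint r mu s.1, skew_rsize r mu s.1) `[< vstrip r mu s.1 >]).
- case: ifP => _; last by rewrite mulr0.
  rewrite /mon es /= exprD.
  by move: (x ^+ _) (y ^+ _) (t ^+ _) (t ^+ _) => u v w z; ring.
- exact: del_list_uniq r_gt0 _ _ (window_sorted _ _).
- move=> /asboolP vs; apply: (vstrip_del_list r_gt0 vs) => p lt_p.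
  by apply: (top_bound r_gt0 vs hs) => //; rewrite lt_p orbT.
- by move=> s' /(mem_del_list r_gt0)[vs _] e; apply/asboolP; rewrite -e.
Qed.

(** The scalar c makes room for the final gauge, which multiplies the indicator of [mu] by a
    constant. *)
Lemma del_add_delta mu nu (c : R) :
  foldr (del_op r t y) (foldr (add_op r t x) (fun lam => c * delta mu lam)
    (strip_window mu nu)) (strip_window mu nu) nu =
  c * \sum_(lam <- bottoms mu nu) mon (bottom_key mu nu lam).
Proof.
rewrite (foldr_move_op (removable r) (del_ribbon r) (ribbon_height r)).
rewrite big_map big_filter [in RHS]big_mkcond -/(del_list r _ _) mulr_sumr.
apply: eq_big_seq => s s_in; have [vs es] := mem_del_list r_gt0 s_in.
rewrite (foldr_move_op (addable r) (add_ribbon r) (ribbon_height r)) -/(add_list r _ _).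
under eq_bigr => s' _ do rewrite /delta mulrA.
rewrite (@big_pick _ _ mu (dspin r s.1 mu, skew_rsize r s.1 mu) `[< hstrip r s.1 mu >]).
- case: ifP => _; last by rewrite !mulr0.
  rewrite /mon es /= exprD.
  by move: (x ^+ _) (y ^+ _) (t ^+ _) (t ^+ _) => u v w z; ring.
- exact: add_list_uniq r_gt0 _ _ (window_sorted _ _).
- move=> /asboolP hs; apply: (hstrip_add_list r_gt0 hs) => p lt_p.
  by apply: dg_bound lt_p; lia.
- by move=> s' /(mem_add_list r_gt0)[hs _] e; apply/asboolP; rewrite -e.
Qed.

Lemma tops_bottoms mu nu :
  \sum_(kap <- tops mu nu) mon (top_key mu nu kap) =
  (\prod_(i < r) (1 + t ^+ (2 * i) * x * y)) *
    \sum_(lam <- bottoms mu nu) mon (bottom_key mu nu lam).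
Proof.
rewrite -add_del_delta -del_add_delta /strip_window; set N := (_ + _ + r)%N.
have := congr1 (@^~ nu) (gauge_window r_gt0 t x y (- N%:Z) (N + N) (delta mu)).
rewrite {1}/gauge.
(* At the left end all r places of the window are occupied, so the gauge is an empty product. *)
have -> : (dg nu (- N%:Z - 1) - dg nu (- N%:Z + r%:Z - 1))%N = r.
  have := @dg_low nu (- N%:Z - 1); have := @dg_low nu (- N%:Z + r%:Z - 1); lia.
rewrite {1}/gauge_weight big_geq // mul1r => ->.
congr (foldr _ (foldr _ _ _) _ nu); apply/funext => lam; rewrite /gauge /delta.
case: eqP => [->|_]; last by rewrite !mulr0.
(* At the right end there are no beads, so the gauge is the full product. *)
have -> : - N%:Z + (N + N)%N%:Z = N%:Z by lia.
rewrite !dg_high ?subnn; try lia.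
by rewrite /gauge_weight big_mkord.
Qed.

(** In the expansion, a i tells which of the two terms of factor i is taken. *)
Lemma prod_subsets :
  \prod_(i < r) (1 + t ^+ (2 * i) * x * y) =
  \sum_(a : {ffun 'I_r -> bool}) mon (weight a, (weight a, (2 * nstat a)%N)).
Proof.
transitivity (\prod_(i < r) \sum_(b : bool) (if b then t ^+ (2 * i) * x * y else 1)).
  by apply: eq_bigr => i _; rewrite big_bool addrC.
rewrite bigA_distr_bigA; apply: eq_bigr => a _.
rewrite /mon /weight /nstat big_distrr /= !expr_sum -!big_split; apply: eq_bigr => i _ /=.
by case: (a i); rewrite ?muln1 ?muln0 ?expr0 ?expr1 ?mulr1 //; ring.
Qed.

End CauchyIdentity.

(** * From equal generating functions to bijections *)

Section Counting.

Definition key := (nat * (nat * nat))%type.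
Definition qhalfC : {poly {poly Zq}} := qhalf%:P%:P.
Local Notation mono := (mon qhalfC varX varY).

Lemma coef_mon (k : key) m n : ((mono k)`_m)`_n =
  if (k.1 == m) && (k.2.1 == n) then qhalf ^+ k.2.2 else 0.
Proof.
rewrite /mon /varX /varY /qhalfC -mulrA coefXnM; case: k => [a [b c]] /=.
rewrite -!rmorphXn /= -rmorphM /= coefC.
case: (ltngtP m a) => [_|lt_am|->] /=; rewrite ?coef0 //.
  by rewrite subn_eq0 leqNgt lt_am coef0.
rewrite subnn eqxx coefXnM coefC.
case: (ltngtP n b) => [_|lt_bn|->] //=; last by rewrite subnn.
by rewrite subn_eq0 leqNgt lt_bn.
Qed.

(** Distinct keys give distinct monomials in X, Y and q^(1/2), so the multiplicity of a key is an
    integer coefficient of the sum. *)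
Lemma sum_mon_perm (s s' : seq key) :
  \sum_(k <- s) mono k = \sum_(k <- s') mono k -> perm_eq s s'.
Proof.
move=> eq_s; apply/allP => k _ /=.
have countE (u : seq key) :
    (((\sum_(k' <- u) mono k')`_k.1)`_k.2.1)`_k.2.2 = (count_mem k u)%:R :> int.
  rewrite -sum1_count natr_sum [RHS]big_mkcond !coef_sum; apply: eq_bigr => k' _ /=.
  rewrite coef_mon; case: k k' => [a [b c]] [a' [b' c']] /=; rewrite !xpair_eqE.
  case: (a' == a); rewrite ?coef0 //=; case: (b' == b); rewrite ?coef0 //=.
  by rewrite /qhalf coefXn eq_sym; case: eqP.
by rewrite -(eqr_nat int) -!countE eq_s.
Qed.

(** The bijection sends the element at an index of s to the element of s' at the index matched by
    the permutation [Is]. *)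
Lemma perm_map_bij (S T K : eqType) (s : seq S) (s' : seq T) (f : S -> K) (g : T -> K)
    (t0 : T) : uniq s -> uniq s' -> perm_eq (map f s) (map g s') ->
  exists h : S -> T, [/\ {in s, forall z, h z \in s' /\ g (h z) = f z},
    {in s &, injective h} & {in s', forall w, exists2 z, z \in s & h z = w}].
Proof.
move=> us us' /(perm_iotaP (g t0)) [Is perm_Is eq_f].
have size_Is : size Is = size s by rewrite -(size_map f) eq_f size_map.
have uIs : uniq Is by rewrite (perm_uniq perm_Is) iota_uniq.
have Is_lt i : i \in Is -> (i < size s')%N.
  by rewrite (perm_mem perm_Is) mem_iota size_map.
pose h z := nth t0 s' (nth 0%N Is (index z s)).
have idx_lt z : z \in s -> (nth 0%N Is (index z s) < size s')%N.
  by move=> z_in; apply/Is_lt/mem_nth; rewrite size_Is index_mem.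
exists h; split=> [z z_in|z z' z_in z'_in|w w_in].
- split; first by rewrite mem_nth ?idx_lt.
  rewrite -[f z](_ : nth (g t0) (map f s) (index z s) = _); last first.
    by rewrite (nth_map z) ?index_mem // nth_index.
  by rewrite eq_f (nth_map 0%N) ?size_Is ?index_mem // (nth_map t0) ?idx_lt.
- move/eqP; rewrite /h nth_uniq ?idx_lt // nth_uniq ?size_Is ?index_mem //.
  by move/eqP/(congr1 (nth z s)); rewrite !nth_index.
have i_in : index w s' \in Is.
  by rewrite (perm_mem perm_Is) mem_iota size_map index_mem.
have i_lt : (index (index w s') Is < size s)%N by rewrite -size_Is index_mem.
(* The bound [i_lt] excludes an empty s, whose head then serves as default for [nth]. *)
case: s us size_Is i_lt {eq_f} @h {idx_lt} => // z0 s us size_Is i_lt h.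
exists (nth z0 (z0 :: s) (index (index w s') Is)); first exact: mem_nth.
by rewrite /h index_uniq // nth_index // nth_index.
Qed.

End Counting.

(** * Construction of the shape datum *)

Section ShapeDatum.
Variables (r : nat) (r_gt0 : (0 < r)%N).
Implicit Types lam mu nu kap : intpart.

Definition pairs mu nu : seq ({ffun 'I_r -> bool} * intpart) :=
  [seq (a, lam) | a <- index_enum {ffun 'I_r -> bool}, lam <- bottoms r mu nu].

Definition pair_key mu nu (z : {ffun 'I_r -> bool} * intpart) : key :=
  let k := bottom_key r mu nu z.2 in
  (weight z.1 + k.1, (weight z.1 + k.2.1, 2 * nstat z.1 + k.2.2))%N.

(** [tops_bottoms] is read in the polynomial ring, with its right side expanded over the pairs (a,
    lam) by [prod_subsets]; [pair_key] adds the exponents of the two monomials. *)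
Lemma tops_pairs_perm mu nu :
  perm_eq (map (top_key r mu nu) (tops r mu nu)) (map (pair_key mu nu) (pairs mu nu)).
Proof.
apply: sum_mon_perm; rewrite big_map [RHS]big_map big_allpairs (tops_bottoms r_gt0) prod_subsets.
rewrite mulr_suml; apply: eq_bigr => a _; rewrite mulr_sumr; apply: eq_bigr => lam _.
by rewrite /mon /= !exprD mulrACA [X in X * _ = _]mulrACA.
Qed.

Lemma pairs_uniq mu nu : uniq (pairs mu nu).
Proof.
apply: allpairs_uniq; rewrite ?index_enum_uniq ?bottoms_uniq //.
by move=> [a b] [a' b'] _ _ /= [-> ->].
Qed.

Lemma mem_pairs mu nu z : (z \in pairs mu nu) = (z.2 \in bottoms r mu nu).
Proof.
apply/allpairsP/idP => [[[a lam] [_ lam_in ->]] //|lam_in].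
by exists z; rewrite mem_index_enum lam_in -surjective_pairing.
Qed.

Lemma shape_bijection : exists b : intpart -> intpart -> intpart -> {ffun 'I_r -> bool} * intpart,
  forall mu nu,
  [/\ {in tops r mu nu, forall kap, b mu nu kap \in pairs mu nu /\
         pair_key mu nu (b mu nu kap) = top_key r mu nu kap},
      {in tops r mu nu &, injective (b mu nu)} &
      {in pairs mu nu, forall z, exists2 kap, kap \in tops r mu nu & b mu nu kap = z}].
Proof.
have ex (mn : intpart * intpart) := perm_map_bij ([ffun=> false], mn.1)
  (tops_uniq r_gt0 mn.1 mn.2) (pairs_uniq mn.1 mn.2) (tops_pairs_perm mn.1 mn.2).
by have [b bP] := choice ex; exists (fun mu nu => b (mu, nu)) => mu nu; exact: bP (mu, nu).
Qed.

Lemma rsize_chain lam mu : hstrip r lam mu \/ vstrip r lam mu ->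
  rsize r mu = (rsize r lam + skew_rsize r lam mu)%N.
Proof.
by case=> -[c [ch _]]; rewrite /rsize; have [-> _] := skew_rsizeE r_gt0 ch;
   rewrite addnC divnMDl // addnC.
Qed.

Lemma shape_datum_exists : exists b : intpart -> intpart -> intpart ->
              {ffun 'I_r -> bool} * intpart,
     shape_datum b /\
     forall (mu nu kappa lam : intpart) (a : {ffun 'I_r -> bool}),
       vstrip r mu kappa -> hstrip r nu kappa -> b mu nu kappa = (a, lam) ->
       spint r mu kappa + spin r nu kappa
       = spin r lam mu + spint r lam nu + (nstat a)%:R.
Proof.
have [b bP] := shape_bijection.
have inT mu nu kap : vstrip r mu kap -> hstrip r nu kap -> kap \in tops r mu nu.
  by move=> vs hs; rewrite (mem_tops r_gt0); apply/asboolP.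
exists b; split=> [mu nu|mu nu kap lam a vs hs eb].
  have [b_key b_inj b_surj] := bP mu nu; split; first split.
  - move=> kap [vs hs] /=; have [+ _] := b_key kap (inT _ _ _ vs hs).
    by rewrite mem_pairs (mem_bottoms r_gt0) => /asboolP.
  - move=> kap kap' /set_mem[vs hs] /set_mem[vs' hs'].
    by apply: b_inj; exact: inT.
  - move=> z zP; have /b_surj[kap] : z \in pairs mu nu.
      by rewrite mem_pairs (mem_bottoms r_gt0); apply/asboolP.
    by rewrite (mem_tops r_gt0) => /asboolP ? <-; exists kap.
  move=> kap a lam vs hs eb; have [+ ek] := b_key kap (inT _ _ _ vs hs).
  rewrite mem_pairs (mem_bottoms r_gt0) eb => /asboolP[hs' vs'].
  (* Equality of the exponents of X is the weight condition. *)
  move: ek; rewrite eb /pair_key /top_key /= => -[e1 _ _].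
  rewrite (rsize_chain (or_introl hs)) (rsize_chain (or_introl hs')) -e1 /=.
  by rewrite !PoszD; ring.
have [b_key _ _] := bP mu nu; have [_] := b_key kap (inT _ _ _ vs hs).
(* Equality of the exponents of q^(1/2), once halved, is the spin relation. *)
rewrite eb /pair_key /top_key /= /spin /spint => -[_ _ e].
rewrite -!mulrDl -!natrD -e natrD natrM mulrDl addrC; congr (_ + _).
by rewrite mulrAC divff ?mul1r.
Qed.

End ShapeDatum.

(** * The commutation relation in End(Z[q^(1/2)]Y)[[X,Y]] *)

Section Coefficients.
Variables (r : nat) (r_gt0 : (0 < r)%N).
Implicit Types lam mu nu kap : intpart.

Local Notation mono := (mon qhalfC varX varY).

(** Fixing m fixes the size of [mu], so one window serves all of them. Finiteness is what gives the
    sum in [Ucoef] its intended value. *)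
Lemma finite_hstrips m nu :
  finite_set [set mu | hstrip r nu mu /\ skew_rsize r nu mu = m]%classic.
Proof.
pose N := (psize nu + m * r)%N.
pose W := window (- N%:Z) (N + N).
apply: (@sub_finite_set _ _ [set` [seq s.1 | s <- add_list r W nu]]%classic);
  last exact: finite_seq.
move=> mu [hs em] /=; apply/mapP.
exists (mu, (dspin r nu mu, skew_rsize r nu mu)) => //.
apply: (hstrip_add_list r_gt0 hs) => p; apply: dg_bound.
by case: hs => c [/(skew_rsizeE r_gt0)[-> _] _]; rewrite em.
Qed.

Lemma finite_vstrips n nu :
  finite_set [set mu | vstrip r mu nu /\ skew_rsize r mu nu = n]%classic.
Proof.
pose N := psize nu.
pose W := window (- N%:Z) (N + N).
apply: (@sub_finite_set _ _ [set` [seq s.1 | s <- del_list r W nu]]%classic);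
  last exact: finite_seq.
move=> mu [vs em] /=; apply/mapP.
exists (mu, (dspint r mu nu, skew_rsize r mu nu)) => //.
by apply: (vstrip_del_list r_gt0 vs) => p; apply: dg_bound.
Qed.

Lemma coeff_fsbig (A : set intpart) (F : intpart -> Zq) mu : finite_set A ->
  coeff mu (\sum_(k \in A) F k *: << k >> : ZqY) = if `[< A mu >] then F mu else 0.
Proof.
move=> finA; rewrite fsbig_finite // raddf_sum /=.
under eq_bigr => k _ do rewrite coeffZ coeffU mul1r.
case: asboolP => [Amu|nA].
  have mu_in : mu \in fset_set A by rewrite in_fset_set // mem_set.
  rewrite (bigD1_seq mu) ?fset_uniq //= eqxx mulr1 big1 ?addr0 // => k /negbTE ->.
  by rewrite mulr0.
rewrite big1_seq // => k /= ; rewrite in_fset_set // => /set_mem Ak.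
by case: eqP => [e|]; [case: nA; rewrite -e | rewrite mulr0].
Qed.

Lemma fglift_fsbig (f : intpart -> ZqY) (A : set intpart) (F : intpart -> Zq) :
  finite_set A ->
  fglift f (\sum_(k \in A) F k *: << k >> : ZqY) = \sum_(k <- fset_set A) F k *: f k.
Proof.
move=> finA; rewrite fsbig_finite // linear_sum; apply: eq_bigr => k _.
by rewrite linearZ /= liftU scale1r.
Qed.

Lemma fglift0 (w : ZqY) : fglift (fun=> 0 : ZqY) w = 0.
Proof.
by rewrite -[w]freeg_sumE linear_sum big1 // => k _; rewrite /= liftU scaler0.
Qed.

Lemma linear_freeg_ext (F G : {linear ZqY -> ZqY}) :
  (forall k, F << k >> = G << k >>) -> F =1 G.
Proof.
move=> eqFG v; have vE : v = \sum_(k <- dom v) coeff k v *: << k >>.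
  rewrite -{1}[v]freeg_sumE; apply: eq_bigr => k _.
  by apply/eqP/freeg_eqP => z; rewrite coeffZ !coeffU mul1r.
by rewrite vE !linear_sum; apply: eq_bigr => k _; rewrite !linearZ /= eqFG.
Qed.

Lemma DtU_coef m n nu mu :
  coeff mu (opcomp (opDt r) (opU r) m n << nu >>) =
  ((\sum_(kap <- tops r mu nu) mono (top_key r mu nu kap))`_m)`_n.
Proof.
(* One term of the double sum survives, since U involves no Y and D~ no X. *)
have -> : opcomp (opDt r) (opU r) m n << nu >> = fglift (Dtcoef r n) (Ucoef r m nu).
  rewrite /opcomp /= /comp_coef big_ord_recl /= [X in _ + X]big1 ?addr0; last first.
    by move=> i _; rewrite big1 // => j _; rewrite /opDt /= fglift0.
  rewrite big_ord_recr /= big1 ?add0r; last first.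
    move=> j _; rewrite /opU /= subn_eq0 leqNgt ltn_ord /= fglift0.
    by rewrite raddf0.
  by rewrite /opDt /opU subnn subn0 eqxx liftU scale1r.
rewrite fglift_fsbig; last exact: finite_hstrips.
rewrite raddf_sum !coef_sum /=.
under eq_bigr => kap _ do rewrite coeffZ /Dtcoef (coeff_fsbig _ _ (finite_vstrips n kap)).
under [RHS]eq_bigr => kap _ do rewrite coef_mon /=.
rewrite -[RHS]big_mkcond -[RHS]big_filter.
rewrite (eq_bigr (fun kap => if `[< vstrip r mu kap /\ skew_rsize r mu kap = n >]
  then qhalf ^+ (dspint r mu kap + dspin r nu kap) else 0)); last first.
  by move=> kap _; case: ifP => _; rewrite ?mulr0 // addnC exprD.
(* Both sides have the same summand; it remains to compare the index sets, one cut out of the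
   horizontal strips of size m over [nu], the other out of [tops]. *)
rewrite -[LHS]big_mkcond -[LHS]big_filter; apply: perm_big; apply: uniq_perm.
- by apply/filter_uniq/fset_uniq.
- by apply: filter_uniq; exact: tops_uniq.
move=> kap; rewrite !mem_filter in_fset_set ?(mem_tops r_gt0); last exact: finite_hstrips.
apply/idP/idP => [/andP[/asboolP[vs en] /set_mem[hs em]]|].
  by rewrite em en !eqxx; apply/asboolP.
case/andP=> /andP[/eqP em /eqP en] /asboolP[vs hs].
by apply/andP; split; [apply/asboolP | apply/mem_set].
Qed.

Lemma UDt_coef m n nu mu :
  coeff mu (opcomp (opU r) (opDt r) m n << nu >>) =
  ((\sum_(lam <- bottoms r mu nu) mono (bottom_key r mu nu lam))`_m)`_n.
Proof.
have -> : opcomp (opU r) (opDt r) m n << nu >> = fglift (Ucoef r m) (Dtcoef r n nu).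
  rewrite /opcomp /= /comp_coef big_ord_recr /= [X in X + _]big1 ?add0r; last first.
    move=> i _; rewrite big1 // => j _.
    by rewrite /opDt /= subn_eq0 leqNgt ltn_ord /= fglift0 raddf0.
  rewrite big_ord_recl /= [X in _ + X]big1 ?addr0; last first.
    by move=> j _; rewrite /opU /= fglift0.
  by rewrite /opDt /opU subnn subn0 eqxx liftU scale1r.
rewrite fglift_fsbig; last exact: finite_vstrips.
rewrite raddf_sum !coef_sum /=.
under eq_bigr => lam _ do rewrite coeffZ /Ucoef (coeff_fsbig _ _ (finite_hstrips m lam)).
under [RHS]eq_bigr => lam _ do rewrite coef_mon /=.
rewrite -[RHS]big_mkcond -[RHS]big_filter.
rewrite (eq_bigr (fun lam => if `[< hstrip r lam mu /\ skew_rsize r lam mu = m >]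
  then qhalf ^+ (dspin r lam mu + dspint r lam nu) else 0)); last first.
  by move=> lam _; case: ifP => _; rewrite ?mulr0 // addnC exprD.
rewrite -[LHS]big_mkcond -[LHS]big_filter; apply: perm_big; apply: uniq_perm.
- by apply/filter_uniq/fset_uniq.
- by apply: filter_uniq; exact: bottoms_uniq.
move=> lam; rewrite !mem_filter in_fset_set ?(mem_bottoms r_gt0); last exact: finite_vstrips.
apply/idP/idP => [/andP[/asboolP[hs em] /set_mem[vs en]]|].
  by rewrite em en !eqxx; apply/asboolP.
case/andP=> /andP[/eqP em /eqP en] /asboolP[hs vs].
by apply/andP; split; [apply/asboolP | apply/mem_set].
Qed.

(** Comparing the coefficients of [mu] in the images of [nu] reduces this to [tops_bottoms] at t =
    q^(1/2), x = X, y = Y. *)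
Lemma DtU_commutation m n : opcomp (opDt r) (opU r) m n
  =1 opscale (opcomp (opU r) (opDt r))
       (\prod_(i < r) (1 + (q ^+ i)%:P%:P * varX * varY)) m n.
Proof.
apply: linear_freeg_ext => nu; apply/eqP/freeg_eqP => mu; rewrite DtU_coef.
rewrite (tops_bottoms r_gt0).
have -> : \prod_(i < r) (1 + (q ^+ i)%:P%:P * varX * varY) =
    \prod_(i < r) (1 + qhalfC ^+ (2 * i) * varX * varY).
  by apply: eq_bigr => i _; rewrite /qhalfC /q -exprM -!rmorphXn.
(* [scale_coef] takes the complementary index in P, so P must be the second factor of the
   product. *)
set P := \prod_(i < r) _; rewrite mulrC /opscale /= /scale_coef raddf_sum coefM coef_sum.
apply: eq_bigr => i _; rewrite coefM raddf_sum; apply: eq_bigr => j _ /=.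
by rewrite coeffZ UDt_coef mulrC.
Qed.

End Coefficients.

Unset Implicit Arguments.

Theorem theorem6p3 (r : nat) (r_gt0 : (0 < r)%N) :
  (exists b : intpart -> intpart -> intpart ->
              {ffun 'I_r -> bool} * intpart,
     shape_datum b /\
     forall (mu nu kappa lam : intpart) (a : {ffun 'I_r -> bool}),
       vstrip r mu kappa -> hstrip r nu kappa -> b mu nu kappa = (a, lam) ->
       spint r mu kappa + spin r nu kappa
       = spin r lam mu + spint r lam nu + (nstat a)%:R) /\
  (forall m n : nat,
     opcomp (opDt r) (opU r) m n
     =1 opscale (opcomp (opU r) (opDt r))
          (\prod_(i < r) (1 + (q ^+ i)%:P%:P * varX * varY)) m n).
Proof.
split; first exact: shape_datum_exists.
exact: DtU_commutation.
Qed.
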